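(* Let $1\le k\le d$ and let $P$ be a $d$-polytope with $d+k$ vertices, of which at most $d-1$ are nonsimple. Then $P$ is a $(d-k)$-fold pyramid over a $k$-polytope with $2k$ vertices.
   Context: A $d$-polytope is a convex polytope of dimension $d$. A vertex of a $d$-polytope is simple if exactly $d$ edges of the polytope are incident to it (equivalently, it lies in exactly $d$ facets), and nonsimple otherwise. A polytope is a pyramid with basis $F$ and apex $u$ if it is the convex hull of a facet $F$ and one further vertex $u\notin F$. Multifold pyramids are defined recursively: a $0$-fold pyramid over $Q$ is $Q$ itself, and an $r$-fold pyramid over $Q$ is a pyramid whose basis is an $(r-1)$-fold pyramid over $Q$. All statements are up to combinatorial equivalence (isomorphism of face lattices). *)

(* Defs.v *)
From mathcomp Require Import all_boot all_order all_algebra.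
From mathcomp Require Import boolp classical_sets functions cardinality reals.
From mathcomp Require Import convex.

Set Implicit Arguments.
Unset Strict Implicit.
Unset Printing Implicit Defensive.

Import Order.TTheory GRing.Theory Num.Theory.

Local Open Scope classical_set_scope.
Local Open Scope ring_scope.
Local Open Scope card_scope.

Section Polytopes.
Variables (R : realType) (n : nat).
Local Notation V := 'rV[R]_n.
Implicit Types (A P Q F E : set V) (u v : V) (d r : nat).

Definition conv_hull A : set V := smallest (@convex_set R V) A.

Definition affine_set A : Prop :=
  forall (x y : V) (t : R), A x -> A y -> A (t *: x + (1 - t) *: y).

Definition affine_hull A : set V := smallest affine_set A.

(* The empty set has no dimension in this sense; its conventional dimension -1
   is never used. *)
Definition has_dim A d : Prop :=
  exists (p : V) (U : {vspace V}),
    affine_hull A = [set x | x - p \in U] /\ \dim U = d.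

Definition is_polytope d P : Prop :=
  (exists2 S : set V, finite_set S & P = conv_hull S) /\ has_dim P d.

(* Linear inequalities x *m c <= b valid on P; c = 0 yields the improper
   faces P (b = 0) and set0 (b = 1). *)
Definition is_face P F : Prop :=
  exists (c : 'cV[R]_n) (b : R),
    (forall x, P x -> (x *m c) 0 0 <= b) /\
    F = P `&` [set x | (x *m c) 0 0 = b].

Definition vertices P : set V := [set v | is_face P [set v]].

Definition is_edge P E : Prop := is_face P E /\ has_dim E 1%N.

Definition is_facet P F : Prop :=
  exists d, [/\ has_dim P d.+1, is_face P F & has_dim F d].

(* v is meant to be a vertex of the d-polytope P. *)
Definition is_simple d P v : Prop :=
  [set E | is_edge P E /\ E v] #= `I_d.

Definition nonsimple_vertices d P : set V :=
  [set v | vertices P v /\ ~ is_simple d P v].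

Definition is_pyramid P F u : Prop :=
  [/\ is_facet P F, vertices P u, ~ F u & P = conv_hull (F `|` [set u])].

Fixpoint is_multifold_pyramid r Q P : Prop :=
  if r is r'.+1 then
    exists F u, is_pyramid P F u /\ is_multifold_pyramid r' Q F
  else P = Q.

End Polytopes.

(* Main.v *)
Require Import Defs.
From HB Require Import structures.
From mathcomp Require Import all_boot all_order all_algebra.
From mathcomp Require Import boolp classical_sets functions cardinality reals.
From mathcomp Require Import interval_inference convex lra ring zify.

(** Everything reduces to one fact, [few_nonsimple_pyramid]: a d-polytope P with
    fewer than 2d vertices, at most d - 1 of them nonsimple, is a pyramid.  The
    base of that pyramid has one dimension and one vertex less.  It has at most
    d - 2 nonsimple vertices: either the apex was nonsimple in P, or the apex
    was simple and then the base is a simplex.  So the fact can be applied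
    again until dimension k is reached, where 2k vertices are left
    ([multifold_pyramid]).

    The fact is proved by induction on d.  Among the facets that contain at most
    d - 2 nonsimple vertices, let F be one with the most vertices.  If F has at
    least 2(d - 1) vertices, only one vertex is left outside F and P is a pyramid
    over F.  Otherwise the induction hypothesis applies to F, which is thus a
    pyramid with some apex w over a ridge K.

    A simple vertex u of F has exactly one neighbour o outside F, and o lies on
    every other facet through u ([simple_outer]).  Also, if one vertex o outside
    F lies on every facet that meets F in a ridge, then P is the pyramid over F
    with apex o ([pyramid_of_common_apex]).  So it is enough to find a single
    o that is the outer neighbour of some simple vertex on each ridge of F.

    If w is nonsimple ([pyramid_of_nonsimple_apex]), let G be the other facet
    through K.  It misses w, so it competes with F in the choice of F.  By
    maximality G has only one vertex o outside K.  All simple vertices of F lie in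
    K, hence in G, so o is their common outer neighbour.  Each ridge of F has at
    least d - 1 vertices, hence a simple one.

    If w is simple, F is a simplex.  If F still contains a nonsimple vertex, that
    vertex is also an apex of F and the previous case applies.  If all d
    vertices of F are simple ([pyramid_of_simple_simplex]), two of them share
    their outer neighbour, as otherwise P would have 2d vertices; every ridge of
    F contains one of the two.

    The geometry rests on Farkas' lemma.  It shows that the cone of P at a vertex
    u is generated by the edges at u, so that a vertex is simple exactly when
    these generators are linearly independent.  Then the faces through u
    correspond to sets of neighbours of u. *)

Set Implicit Arguments.
Unset Strict Implicit.
Unset Printing Implicit Defensive.

Import Order.TTheory GRing.Theory Num.Theory.

Local Open Scope classical_set_scope.
Local Open Scope ring_scope.
Local Open Scope card_scope.

(** * Linear functionals and Farkas' lemma *)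

Section LinearFunctionals.
Variables (R : realFieldType) (n : nat).
Local Notation V := 'rV[R]_n.
Implicit Types (c : 'cV[R]_n) (W : {vspace V}).

Definition dot c (x : V) : R := (x *m c) 0 0.

Lemma dot_is_linear c : linear (dot c : V -> R^o).
Proof. by move=> a x y; rewrite /dot mulmxDl -scalemxAl !mxE. Qed.

HB.instance Definition _ c :=
  GRing.isLinear.Build R V R^o _ (dot c) (dot_is_linear c).

Lemma dotDl c c' x : dot (c + c') x = dot c x + dot c' x.
Proof. by rewrite /dot mulmxDr mxE. Qed.

Lemma dotZl a c x : dot (a *: c) x = a * dot c x.
Proof. by rewrite /dot -scalemxAr mxE. Qed.

Lemma dotZ c a x : dot c (a *: x) = a * dot c x.
Proof. exact: (linearZ_LR (dot c)). Qed.

Lemma dotD c x y : dot c (x + y) = dot c x + dot c y.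
Proof. exact: (linearD (dot c)). Qed.

Lemma dotB c x y : dot c (x - y) = dot c x - dot c y.
Proof. exact: (linearB (dot c)). Qed.

Lemma dotN c x : dot c (- x) = - dot c x.
Proof. exact: (linearN (dot c)). Qed.

Lemma dot0 c : dot c 0 = 0.
Proof. exact: (linear0 (dot c)). Qed.

Lemma dot0l x : dot 0 x = 0.
Proof. by rewrite /dot mulmx0 mxE. Qed.

Lemma dot_big c (T : Type) (s : seq T) (F : T -> V) :
  dot c (\sum_(i <- s) F i) = \sum_(i <- s) dot c (F i).
Proof. exact: (linear_sum (dot c)). Qed.

Lemma dot_sum c (T : Type) (s : seq T) (l : T -> R) (a : T -> V) :
  dot c (\sum_(i <- s) l i *: a i) = \sum_(i <- s) l i * dot c (a i).
Proof.
by rewrite dot_big; apply: eq_bigr => i _; rewrite dotZ.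
Qed.

Lemma functional_dot (f : {linear V -> R^o}) : exists c, dot c =1 f.
Proof.
exists (\col_i f (delta_mx 0 i)) => x.
rewrite [in RHS](row_sum_delta x) linear_sum /dot mxE.
by apply: eq_bigr => i _; rewrite mxE (linearZ_LR f).
Qed.

(** The functional is a coordinate of the component of x along a complement
    of W, scaled to be positive at x. *)
Lemma separate_vspace W x : x \notin W ->
  exists c, (forall w, w \in W -> dot c w = 0) /\ 0 < dot c x.
Proof.
move=> xW; pose y := x - projv W x.
have y0 : y != 0.
  by rewrite subr_eq0; apply: contraNneq xW => ->; exact: memv_proj.
have [j yj] : exists j, y 0 j != 0.
  apply/existsP; apply: contraNT y0; rewrite negb_exists => /forallP h.
  by apply/eqP/rowP => j; rewrite [RHS]mxE; apply/eqP/negPn; exact: h.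
pose f (z : V) : R^o := (y 0 j) * (z - projv W z) 0 j.
have flin : linear f.
  move=> a u v; rewrite /f linearP /= !mxE -[RHS]/(a * _ + _); ring.
pose fl : {linear V -> R^o} := HB.pack f (GRing.isLinear.Build R V R^o _ f flin).
have [c cf] := functional_dot fl; exists c; split => [w wW|].
  by rewrite cf /= /f projv_id // subrr [X in _ * X]mxE mulr0.
by rewrite cf /= /f -/y -expr2 lt_neqAle sqr_ge0 eq_sym sqrf_eq0 yj.
Qed.

Lemma span_dot0 (T : eqType) c (s : seq T) (a : T -> V) w :
  (forall i, i \in s -> dot c (a i) = 0) ->
  w \in <<[seq a i | i <- s]>>%VS -> dot c w = 0.
Proof.
move=> h; rewrite -{1}[[seq a i | i <- s]](in_tupleE) => /coord_span ->.
rewrite dot_big big1 // => i _; rewrite dotZ.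
have /mapP[j js ->] : (in_tuple [seq a i | i <- s])`_i \in [seq a i | i <- s].
  by apply: mem_nth.
by rewrite h // mulr0.
Qed.

Section Farkas.
Variable T : eqType.
Implicit Types (s : seq T) (a : T -> V).

(** Bartl's inductive proof.  The functional must vanish on W so that
    equality constraints are available too. *)
Lemma farkas W s a x : uniq s ->
  (exists2 l : T -> R, forall i, 0 <= l i & x - \sum_(i <- s) l i *: a i \in W)
  \/ (exists c, [/\ forall w, w \in W -> dot c w = 0,
        forall i, i \in s -> dot c (a i) <= 0 & 0 < dot c x]).
Proof.
elim: s a x => [|j s IH] a x /=.
  move=> _; have [xW|xW] := boolP (x \in W).
    by left; exists (fun=> 0) => //; rewrite big_nil subr0.
  by right; have [c [h1 h2]] := separate_vspace xW; exists c; split.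
move=> /andP[js us]; have [[l l0 lx]|[c [cW cs cx]]] := IH a x us.
  left; exists (fun i => if i == j then 0 else l i).
    by move=> i; case: ifP.
  rewrite big_cons eqxx scale0r add0r; congr (_ - _ \in W): lx.
  by apply: eq_big_seq => i iS; case: eqP => // ij; rewrite -ij iS in js.
have [cj|cj] := lerP (dot c (a j)) 0.
  by right; exists c; split => // i; rewrite inE => /predU1P[->|/cs].
(* c fails only at a j: subtract the multiples of a j that bring the other
   generators and x into the kernel of c, and use induction there. *)
pose r y := dot c y / dot c (a j).
have [[l l0 lx]|[c' [cW' cs' cx']]] :=
    IH (fun i => a i - r (a i) *: a j) (x - r x *: a j) us.
  left; exists (fun i => if i == j then r x - \sum_(k <- s) l k * r (a k) else l i).
    move=> i; case: ifP => // _; rewrite subr_ge0.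
    apply: (@le_trans _ _ 0); last by rewrite divr_ge0 // ltW.
    rewrite big_seq; apply: sumr_le0 => k ks; rewrite mulr_ge0_le0 //.
    by rewrite mulr_le0_ge0 // ?cs // invr_ge0 ltW.
  have E1 : \sum_(i <- s) l i *: (a i - r (a i) *: a j) =
      \sum_(i <- s) l i *: a i - (\sum_(k <- s) l k * r (a k)) *: a j.
    by under eq_bigr do rewrite scalerBr scalerA; rewrite sumrB -scaler_suml.
  move: lx; rewrite E1 big_cons eqxx; congr (_ \in W).
  rewrite [in RHS](eq_big_seq (fun i => l i *: a i)) => [|i iS]; last first.
    by case: eqP => // ij; rewrite -ij iS in js.
  move: (\sum_(i <- s) _) (\sum_(i <- s) _) => A B.
  by rewrite scalerBl !opprD !opprK -!addrA; congr (_ + (_ + _)); exact: addrC.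
right; exists (c' - (dot c' (a j) / dot c (a j)) *: c).
have E y : dot (c' - (dot c' (a j) / dot c (a j)) *: c) y
         = dot c' (y - r y *: a j).
  rewrite dotDl -scaleNr dotZl dotB dotZ /r; field; exact: lt0r_neq0.
split=> [w wW|i|]; rewrite E //.
  by rewrite /r cW // mul0r scale0r subr0 cW'.
rewrite inE => /predU1P[->|/cs' //].
by rewrite /r divff ?lt0r_neq0 // scale1r subrr dot0.
Qed.

(** If no nontrivial nonnegative combination of the a i lies in W, then each
    - a i is outside the cone generated by W and the a j.  The functionals that
    separate them, one for each i, add up to a strict one. *)
Lemma farkas_strict W s a : uniq s ->
  (exists2 l : T -> R, forall i, 0 <= l i &
     \sum_(i <- s) l i *: a i \in W /\ exists2 i, i \in s & 0 < l i)
  \/ (exists2 c, forall w, w \in W -> dot c w = 0 &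
        forall i, i \in s -> dot c (a i) < 0).
Proof.
move=> us; set A := (X in X \/ _); have [|nA] := EM A; [by left|right].
have pointwise i : i \in s -> exists c, [/\ forall w, w \in W -> dot c w = 0,
    forall j, j \in s -> dot c (a j) <= 0 & dot c (a i) < 0].
  move=> iS; have [[l l0 lW]|[c [h1 h2 h3]]] := farkas W a (- a i) us.
    case: nA; exists (fun k => l k + (k == i)%:R).
      by move=> k; rewrite addr_ge0 // ler0n.
    split; last by exists i => //; rewrite eqxx ltr_wpDl.
    move: lW; rewrite -memvN opprB opprK; congr (_ \in W).
    under [RHS]eq_bigr do rewrite scalerDl.
    rewrite big_split /=; congr (_ + _).
    rewrite (bigD1_seq i) //= eqxx scale1r big1 ?addr0 // => k /negbTE ->.
    by rewrite scale0r.
  by exists c; split=> //; rewrite -oppr_gt0 -dotN.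
suff /(_ s (fun _ => id)) [c [h1 h2 h3]] : forall t : seq T, {subset t <= s} ->
    exists c, [/\ forall w, w \in W -> dot c w = 0,
      forall j, j \in s -> dot c (a j) <= 0 &
      forall j, j \in t -> dot c (a j) < 0] by exists c.
elim=> [_|i t IH ts].
  by exists 0; split=> // *; rewrite dot0l.
have [|c [h1 h2 h3]] := IH; first by move=> j jt; apply: ts; rewrite inE jt orbT.
have [|c' [h1' h2' h3']] := pointwise i; first by apply: ts; rewrite mem_head.
exists (c + c'); split=> [w wW|j js|j]; rewrite dotDl.
- by rewrite h1 // h1' // addr0.
- by rewrite -[leRHS]addr0 lerD ?h2 ?h2'.
have jS : j \in i :: t -> j \in s by exact: ts.
rewrite inE => jit; have := jS jit; move: jit => /predU1P[->|jt] js.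
  by rewrite -[ltRHS]addr0 ler_ltD ?h2.
by rewrite -[ltRHS]addr0 ltr_leD ?h2' ?h3.
Qed.

(** The value of t is the largest of the ratios f i / - g i.  This is how a
    supporting hyperplane is tilted until it meets a further point. *)
Lemma tightening s (f g : T -> R) : s != [::] ->
  (forall i, i \in s -> g i < 0) ->
  exists2 t, forall i, i \in s -> f i + t * g i <= 0 &
    exists2 i, i \in s & f i + t * g i = 0.
Proof.
elim: s => // j [|k s] IH _ h; have gj : g j < 0 by apply: h; rewrite mem_head.
  exists (- f j / g j) => [i|]; last exists j; rewrite ?mem_head //.
    by rewrite inE => /eqP ->; rewrite divfK ?subrr // lt_eqF.
  by rewrite divfK ?subrr // lt_eqF.
have [//||t ht [i iks it]] := IH _.
  by move=> i iks; apply: h; rewrite inE iks orbT.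
have [le|lt] := lerP (f j + t * g j) 0.
  exists t => [i'|]; first by rewrite inE => /predU1P[->|/ht].
  by exists i => //; rewrite inE iks orbT.
exists (- f j / g j) => [i'|]; last first.
  by exists j; rewrite ?mem_head // divfK ?subrr // lt_eqF.
rewrite inE => /predU1P[->|i'ks]; first by rewrite divfK ?subrr // lt_eqF.
apply: le_trans (ht _ i'ks); rewrite lerD2l ler_wnM2r //.
  by rewrite ltW // h // inE i'ks orbT.
by rewrite ler_ndivlMr //; lra.
Qed.

(** A point outside a cone violates the inequality of a facet of the cone.
    As long as the tight generators span too small a space, the separating
    hyperplane can be tilted about them and x until one more is tight. *)
Lemma farkas_facet s a x : uniq s -> x \in <<[seq a i | i <- s]>>%VS ->
  ~ (exists2 l : T -> R, forall i, 0 <= l i & x = \sum_(i <- s) l i *: a i) ->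
  exists c, [/\ forall i, i \in s -> dot c (a i) <= 0, 0 < dot c x &
    (\dim <<[seq a i | i <- s & dot c (a i) == 0%R]>>).+1
      = \dim <<[seq a i | i <- s]>>].
Proof.
move=> us xD nx; set D := <<_>>%VS in xD *.
pose W c := <<[seq a i | i <- s & dot c (a i) == 0%R]>>%VS.
have WD c : (W c <= D)%VS.
  by apply: sub_span => y /mapP[i]; rewrite mem_filter => /andP[_ iS] ->;
     apply: map_f.
have W0 c w : w \in W c -> dot c w = 0.
  by apply: span_dot0 => i; rewrite mem_filter => /andP[/eqP].
suff IH k : forall c, (forall i, i \in s -> dot c (a i) <= 0) -> 0 < dot c x ->
    (\dim D <= \dim (W c) + k)%N ->
    exists c, [/\ forall i, i \in s -> dot c (a i) <= 0, 0 < dot c x &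
      (\dim (W c)).+1 = \dim D].
  have [[l l0]|[c [_ h2 h3]]] := farkas 0%VS a x us.
    by rewrite memv0 subr_eq0 => /eqP xl; case: nx; exists l.
  by apply: (IH (\dim D) c) => //; rewrite leq_addl.
elim: k => [|k IH] c cs cx.
  rewrite addn0 => le; have : x \in W c.
    by have /eqP -> : W c == D by rewrite eqEdim WD.
  by move=> /W0 x0; rewrite x0 ltxx in cx.
move=> le; have ltD : (\dim (W c) < \dim D)%N.
  rewrite ltn_neqAle dimvS // andbT; apply: contraTneq cx => e.
  have /eqP WcD : W c == D by rewrite eqEdim WD e /=.
  by rewrite W0 ?ltxx // WcD.
have [e|ne] := eqVneq (\dim (W c)).+1 (\dim D); first by exists c.
(* The functional th tilts c: it vanishes on the tight generators and at x,
   but not on all of D. *)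
pose W' := (W c + <[x]>)%VS.
have [i0 i0s i0W] : exists2 i, i \in s & a i \notin W'.
  apply: contrapT => h.
  have : (D <= W')%VS.
    apply/span_subvP => y /mapP[i iS ->]; apply: contrapT => /negP ni.
    by apply: h; exists i.
  move=> /dimvS; rewrite leqNgt => /negP; apply.
  apply: leq_ltn_trans (dimv_add_leqif _ _) _.
  apply: leq_ltn_trans (_ : \dim (W c) + 1 < _)%N.
    by rewrite leq_add2l dim_vline leq_b1.
  by rewrite addn1 ltn_neqAle ne.
have [th [thW thi0]] := separate_vspace i0W.
have thx : dot th x = 0 by apply: thW; apply: (subvP (addvSr _ _)) (memv_line _).
have thWc w : w \in W c -> dot th w = 0.
  by move=> wW; apply: thW; apply: (subvP (addvSl _ _)).
pose s' := [seq i <- s | 0 < dot th (a i)].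
have [||t ht [i1 i1s' i1t]] :=
  tightening (s := s') (g := fun i => - dot th (a i)) (fun i => dot c (a i)).
- by rewrite -has_filter; apply/hasP; exists i0.
- by move=> i; rewrite mem_filter oppr_lt0 => /andP[].
move: i1s'; rewrite mem_filter => /andP[thi1 i1s].
have t0 : t <= 0.
  rewrite leNgt; apply/negP => tp; have := cs _ i1s.
  have : 0 < t * dot th (a i1) by rewrite mulr_gt0.
  by move: i1t; rewrite mulrN; lra.
have E y : dot (c + (- t) *: th) y = dot c y + t * (- dot th y).
  by rewrite dotDl dotZl; ring.
have tight : (W c <= W (c + (- t) *: th)%R)%VS.
  apply: sub_span => y /mapP[i]; rewrite mem_filter => /andP[/eqP ci iS] ->.
  apply: map_f; rewrite mem_filter iS andbT E ci thWc ?oppr0 ?mulr0 ?addr0 //.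
  by apply: memv_span; apply: map_f; rewrite mem_filter ci eqxx.
apply: (IH (c + (- t) *: th)).
- move=> i iS; rewrite E; have [thi|thi] := ltrP 0 (dot th (a i)).
    by apply: ht; rewrite mem_filter thi.
  have := cs _ iS; have : t * (- dot th (a i)) <= 0.
    by rewrite mulr_le0_ge0 // oppr_ge0.
  by move=> *; rewrite -[leRHS]addr0 lerD.
- by rewrite E thx oppr0 mulr0 addr0.
suff lt : (\dim (W c) < \dim (W (c + (- t) *: th)%R))%N.
  by apply: leq_trans le _; rewrite addnS -addSn leq_add2r.
rewrite ltn_neqAle dimvS // andbT; apply: contraTneq thi1 => e.
have /eqP We : W c == W (c + (- t) *: th) by rewrite eqEdim tight e /=.
rewrite thWc ?ltxx // We; apply: memv_span; apply: map_f.
by rewrite mem_filter E i1t eqxx.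
Qed.

End Farkas.
End LinearFunctionals.

(** * Convex hulls of finite sets and their dimension *)

Section Hulls.
Variables (R : realType) (n : nat).
Local Notation V := 'rV[R]_n.
Implicit Types (A B P F G : set V) (s t : seq V) (u v x y : V) (c : 'cV[R]_n).

Lemma convexP A : @convex_set R V A <->
  (forall x y (t : R), 0 <= t -> t <= 1 -> A x -> A y -> A (t *: x + (1 - t) *: y)).
Proof.
split=> [cA x y t t0 t1 Ax Ay|cA x y l].
  by have := cA x y (Itv01 t0 t1) (mem_set Ax) (mem_set Ay); rewrite inE.
by rewrite !inE => Ax Ay; apply: cA.
Qed.

Lemma conv_hull_convex A : @convex_set R V (conv_hull A).
Proof.
apply/convexP => x y t t0 t1 Ax Ay B [cB AB].
by apply: (convexP B).1 => //; [exact: Ax|exact: Ay].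
Qed.

Lemma sub_conv_hull A : A `<=` conv_hull A.
Proof. exact: sub_gen_smallest. Qed.

Lemma conv_hull_sub A B : @convex_set R V B -> A `<=` B -> conv_hull A `<=` B.
Proof. exact: smallest_sub. Qed.

Lemma conv_hullS A B : A `<=` B -> conv_hull A `<=` conv_hull B.
Proof.
by move=> AB; apply: conv_hull_sub (subset_trans AB (@sub_conv_hull B));
   exact: conv_hull_convex.
Qed.

Lemma convex_halfspace c (b : R) : @convex_set R V [set x | dot c x <= b].
Proof.
apply/convexP => x y t t0 t1 /= xb yb; rewrite dotD !dotZ.
have : t * dot c x <= t * b by rewrite ler_wpM2l.
have : (1 - t) * dot c y <= (1 - t) * b by rewrite ler_wpM2l ?subr_ge0.
lra.
Qed.

Lemma conv_hull_dot_le A c (b : R) : (forall y, A y -> dot c y <= b) ->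
  forall x, conv_hull A x -> dot c x <= b.
Proof. by move=> h; apply: conv_hull_sub => //; exact: convex_halfspace. Qed.

Lemma convex_set1 u : @convex_set R V [set u].
Proof.
by apply/convexP => x y t _ _ /= -> ->; rewrite -scalerDl addrC subrK scale1r.
Qed.

Lemma conv_hull1 u : conv_hull [set u] = [set u].
Proof. by apply: smallest_id; exact: convex_set1. Qed.

Lemma convex_combination A (T : eqType) (s : seq T) (l : T -> R) (a : T -> V) :
  @convex_set R V A -> (forall i, 0 <= l i) ->
  (forall i, i \in s -> 0 < l i -> A (a i)) -> \sum_(i <- s) l i = 1 ->
  A (\sum_(i <- s) l i *: a i).
Proof.
move=> /convexP cA l0; suff gen : (forall i, i \in s -> 0 < l i -> A (a i)) ->
    0 < \sum_(i <- s) l i ->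
    A ((\sum_(i <- s) l i)^-1 *: \sum_(i <- s) l i *: a i).
  by move=> sA l1; have := gen sA; rewrite l1 invr1 scale1r; apply.
elim: s => [|i s IH] sA; first by rewrite big_nil ltxx.
rewrite !big_cons; set m := \sum_(j <- s) l j; set S := \sum_(j <- s) _.
have m0 : 0 <= m by rewrite sumr_ge0.
have sA' j : j \in s -> 0 < l j -> A (a j).
  by move=> js; apply: sA; rewrite inE js orbT.
have [lp|] := ltrP 0 (l i); last first.
  move=> li; have -> : l i = 0 by apply/eqP; rewrite eq_le li l0.
  by rewrite scale0r !add0r; exact: IH.
have Ai : A (a i) by apply: sA; rewrite ?mem_head.
have [mp|] := ltrP 0 m; last first.
  move=> mle _; have m00 : m = 0 by apply/eqP; rewrite eq_le mle m0.
  have -> : S = 0.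
    rewrite /S big_seq big1 // => j js; have/eqP := m00.
    rewrite psumr_eq0 // => /allP/(_ j js)/eqP -> //; exact: scale0r.
  by rewrite m00 !addr0 scalerA mulVf ?scale1r // gt_eqF.
move=> tot; have q0 : 0 <= l i / (l i + m) by rewrite divr_ge0 // ltW.
have q1 : l i / (l i + m) <= 1 by rewrite ler_pdivrMr // mul1r lerDl.
have := cA _ _ _ q0 q1 Ai (IH sA' mp).
rewrite scalerDr !scalerA; congr (A (_ *: _ + _ *: _)); first exact: mulrC.
rewrite -/m; field; rewrite !gt_eqF //.
Qed.

Lemma conv_seqP s x : uniq s -> conv_hull [set` s] x <->
  exists l : V -> R, [/\ forall i, 0 <= l i, \sum_(y <- s) l y = 1 &
                        x = \sum_(y <- s) l y *: y].
Proof.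
move=> us; split; last first.
  case=> l [l0 l1 ->]; apply: convex_combination => //.
    exact: conv_hull_convex.
  by move=> i iS _; apply: sub_conv_hull.
move: x; apply: conv_hull_sub => [|y /= ys].
  apply/convexP => x y t t0 t1 [l [l0 l1 ->]] [k [k0 k1 ->]].
  exists (fun i => t * l i + (1 - t) * k i); split.
  - by move=> i; rewrite addr_ge0 // mulr_ge0 // subr_ge0.
  - by rewrite big_split /= -!mulr_sumr l1 k1; ring.
  - by under [RHS]eq_bigr do rewrite scalerDl -!scalerA;
       rewrite big_split /= -!scaler_sumr.
exists (fun i => (i == y)%:R); split; first by move=> i; rewrite ler0n.
  by rewrite (bigD1_seq y) //= eqxx big1 ?addr0 // => i /negbTE ->.
rewrite (bigD1_seq y) //= eqxx scale1r big1 ?addr0 // => i /negbTE ->.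
exact: scale0r.
Qed.

(** Convex combinations with the origin moved to u, the form in which they
    come out of cones with apex u. *)
Lemma conv_cone s u x (l : V -> R) : (forall i, 0 <= l i) ->
  \sum_(y <- s) l y = 1 -> x - u = \sum_(y <- s) l y *: (y - u) ->
  conv_hull [set` s] x.
Proof.
move=> l0 l1; under [X in _ = X -> _]eq_bigr do rewrite scalerBr.
rewrite sumrB -scaler_suml l1 scale1r => /addIr ->.
apply: (convex_combination (A := conv_hull [set` s]) (a := id)) => //; first exact: conv_hull_convex.
by move=> i iS _; exact: sub_conv_hull.
Qed.

Lemma conv_face s c (b : R) : uniq s -> (forall y, y \in s -> dot c y <= b) ->
  conv_hull [set` s] `&` [set x | dot c x = b] =
  conv_hull [set` [seq y <- s | dot c y == b]].
Proof.
move=> us sb; apply/seteqP; split=> [x [/conv_seqP-/(_ us)[l [l0 l1 ->]] /= e]|].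
  apply: convex_combination => //; first exact: conv_hull_convex.
  move=> i iS li; apply: sub_conv_hull; rewrite /= mem_filter iS andbT.
  have : \sum_(y <- s) l y * (b - dot c y) = 0.
    rewrite -[RHS](subrr b) -{3}e dot_sum -[in RHS](mul1r b) -l1 mulr_suml -sumrB.
    by apply: eq_bigr => y _; rewrite mulrBr.
  rewrite big_seq => /eqP; rewrite psumr_eq0; last first.
    by move=> y ys; rewrite mulr_ge0 // subr_ge0 sb.
  by move=> /allP/(_ i iS); rewrite iS /= mulf_eq0 gt_eqF //= subr_eq0 eq_sym.
move=> x hx; split.
  by apply: conv_hullS hx => y /=; rewrite mem_filter => /andP[].
apply/eqP; rewrite eq_le; apply/andP; split.
  by apply: conv_hull_dot_le hx => y /=; rewrite mem_filter => /andP[/eqP ->].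
rewrite -lerN2 -[leLHS]mulN1r -dotZl.
apply: conv_hull_dot_le hx => y /=; rewrite mem_filter => /andP[/eqP e _].
by rewrite dotZl e mulN1r.
Qed.

Definition dirs u s : {vspace V} := <<[seq y - u | y <- s]>>%VS.

Lemma mem_dirs u s y : y \in s -> y - u \in dirs u s.
Proof. by move=> ys; apply: memv_span; apply: map_f. Qed.

Lemma affine_combB (t : R) x y u :
  t *: x + (1 - t) *: y - u = t *: (x - u) + (1 - t) *: (y - u).
Proof. by rewrite !scalerBr addrACA -opprD -scalerDl [t + _]addrC subrK scale1r. Qed.

Lemma affine_hullE u s : u \in s ->
  affine_hull (conv_hull [set` s]) = [set x | x - u \in dirs u s].
Proof.
move=> us; apply/seteqP; split.
  apply: smallest_sub => [x y t /= xD yD|].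
    by rewrite affine_combB; apply: memvD; apply: memvZ.
  apply: conv_hull_sub => [|y /= ys]; last exact: mem_dirs.
  apply/convexP => x y t _ _ /= xD yD.
  by rewrite affine_combB; apply: memvD; apply: memvZ.
move=> x /= xD B [aB sB].
have Bs y : y \in s -> B y by move=> ys; apply: sB; apply: sub_conv_hull.
have Bu := Bs u us.
have BZ a y : B (u + y) -> B (u + a *: y).
  move=> By; have := aB _ _ a By Bu; congr B.
  by rewrite scalerDr addrAC -scalerDl [a + _]addrC subrK scale1r.
have BD y z : B (u + y) -> B (u + z) -> B (u + (y + z)).
  move=> By Bz; have : B (u + 2^-1 *: (y + z)).
    have := aB _ _ 2^-1 By Bz; congr B.
    have -> : 1 - 2^-1 = 2^-1 :> R by field.
    rewrite !scalerDr addrACA -scalerDl (_ : 2^-1 + 2^-1 = 1 :> R) ?scale1r //.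
    by field.
  by move/(BZ 2); rewrite scalerA divff ?scale1r // pnatr_eq0.
suff : forall w, w \in dirs u s -> B (u + w) by move=> /(_ _ xD); rewrite addrC subrK.
move=> w; rewrite /dirs -[X in <<X>>%VS](in_tupleE) => /coord_span ->.
apply: (big_ind (fun w => B (u + w))) => [|y z|i _]; first by rewrite addr0.
  exact: BD.
apply: BZ; have /mapP[y ys ->] : (in_tuple [seq y - u | y <- s])`_i \in
  [seq y - u | y <- s] by apply: mem_nth.
by rewrite addrC subrK; exact: Bs.
Qed.

Lemma has_dimP u s d : u \in s ->
  has_dim (conv_hull [set` s]) d <-> \dim (dirs u s) = d.
Proof.
move=> us; rewrite /has_dim (affine_hullE us); split; last first.
  by move=> <-; exists u, (dirs u s).
case=> p [U [e <-]]; congr (\dim _).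
have up : u - p \in U.
  have : [set x | x - u \in dirs u s] u by rewrite /= subrr mem0v.
  by rewrite e.
apply/vspaceP => w; have := congr1 (fun A : set V => A (u + w)) e.
rewrite /= addrAC subrr add0r -addrA [X in u + X]addrC addrA => h.
have -> : (w \in U) = (u - p + w \in U) by rewrite rpredDl.
by apply/idP/idP; rewrite h.
Qed.

Lemma has_dim_nonempty A d : has_dim A d -> A !=set0.
Proof.
case=> p [U [e _]]; apply/set0P/negP => /eqP A0; move: e.
rewrite A0 /affine_hull (smallest_id (C := @affine_set R n)) => [e|x y t []].
by have : [set x | x - p \in U] p; [rewrite /= subrr mem0v|rewrite -e].
Qed.

End Hulls.

(** * Vertices and faces of a polytope *)

Section Faces.
Variables (R : realType) (n : nat).
Local Notation V := 'rV[R]_n.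
Implicit Types (A B P F G : set V) (s t : seq V) (u v x y : V) (c : 'cV[R]_n).

Lemma conv_hull_nil : conv_hull [set` [::] : seq V] = set0.
Proof.
rewrite -subset0; apply: conv_hull_sub; first by apply/convexP => x y t _ _ [].
by move=> x.
Qed.

(** Used with two choices of Q: having the same hull, which leaves the vertices
    of a polytope, and generating the cone at a vertex, which leaves its
    neighbours. *)
Lemma minimal_sublist (Q : seq V -> Prop) s : uniq s -> Q s ->
  exists t, [/\ uniq t, {subset t <= s}, Q t & forall y, y \in t -> ~ Q (rem y t)].
Proof.
have [k le] := ubnP (size s); elim: k s le => // k IH s le us Qs.
have [h|] := EM (exists2 y, y \in s & Q (rem y s)); last first.
  by move=> h; exists s; split=> // y ys Qy; apply: h; exists y.
case: h => y ys Qy; have [||t [ut ts Qt min]] := IH (rem y s) _ _ Qy.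
- by rewrite size_rem // -ltnS prednK //; case: s ys {le us Qs Qy}.
- exact: rem_uniq.
by exists t; split=> // z /ts /mem_rem.
Qed.

(** A polytope is handled through a duplicate-free list of its vertices, so that
    vertices can be counted and each face becomes a sublist. *)
Definition vertex_list P s :=
  [/\ uniq s, P = conv_hull [set` s] & vertices P = [set` s]].

(** In a minimal list of points with hull P, no point v is in the hull of the
    others, so that some functional is maximal over the list at v only. *)
Lemma exists_vertex_list P S : finite_set S -> P = conv_hull S -> exists s, vertex_list P s.
Proof.
move=> /finite_seqP[s0 ->] ->.
have -> : [set` s0] = [set` undup s0].
  by apply/seteqP; split=> x /=; rewrite mem_undup.
have [s [us ss sP smin]] := minimal_sublist
  (Q := fun t => conv_hull [set` undup s0] = conv_hull [set` t])
  (undup_uniq s0) erefl.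
exists s; rewrite sP; split=> //; apply/seteqP; split=> v.
  case=> c [b [valid vE]].
  have := conv_face us (fun y ys => valid y (sub_conv_hull ys)); rewrite -[LHS]vE.
  case E : [seq y <- s | dot c y == b] => [|y t].
    rewrite conv_hull_nil => /esym v0; have : set0 v by rewrite v0.
    by [].
  move=> vh; have : y \in [seq y <- s | dot c y == b] by rewrite E mem_head.
  have -> : y = v.
    have : conv_hull [set` y :: t] y by apply: sub_conv_hull; rewrite /= mem_head.
    by rewrite -vh.
  by rewrite mem_filter => /andP[].
move=> /= vs; have [[l l0 [lW [i iS li]]]|[c _ cs]] :=
    farkas_strict 0%VS (fun y => y - v) (rem_uniq v us).
  case: (smin v vs); rewrite sP; apply/seteqP; split; last first.
    by apply: conv_hullS => y; exact: mem_rem.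
  apply: conv_hull_sub (@conv_hull_convex _ _ _) _ => y /= ys.
  have [->|yv] := eqVneq y v; last first.
    by apply: sub_conv_hull; rewrite /= mem_rem_uniq // inE yv.
  pose m := \sum_(z <- rem v s) l z.
  have m0 : 0 < m.
    rewrite lt_neqAle sumr_ge0 // andbT eq_sym; apply: contraTneq li => /eqP.
    by rewrite psumr_eq0 // => /allP/(_ i iS)/eqP ->; rewrite ltxx.
  apply: (@conv_cone _ _ _ v v (fun z => l z / m)).
  - by move=> z; rewrite divr_ge0 // ltW.
  - by rewrite -mulr_suml divff // gt_eqF.
  rewrite subrr; under eq_bigr do rewrite mulrC -scalerA.
  by rewrite -scaler_sumr; move: lW; rewrite memv0 => /eqP ->; rewrite scaler0.
have le y : y \in s -> dot c y <= dot c v.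
  move=> ys; have [->|yv] := eqVneq y v; first by [].
  rewrite -subr_le0 -dotB ltW // cs //.
  by rewrite mem_rem_uniq // inE yv.
exists c, (dot c v); split.
  by apply: conv_hull_dot_le => y; exact: le.
rewrite (conv_face us le) -(conv_hull1 v); congr conv_hull.
apply/seteqP; split=> y /=; rewrite mem_filter; first by move=> ->; rewrite eqxx vs.
move=> /andP[/eqP cy ys].
apply/eqP; apply: contraT => yv; have := cs y.
by rewrite mem_rem_uniq // inE yv ys dotB cy subrr ltxx => /(_ isT).
Qed.

Section OnePolytope.
Variables (P : set V) (s : seq V).
Hypothesis Ps : vertex_list P s.

Let us : uniq s. Proof. by case: Ps. Qed.
Let Pconv : P = conv_hull [set` s]. Proof. by case: Ps. Qed.

Lemma vertexP v : vertices P v <-> v \in s.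
Proof. by case: Ps => _ _ ->. Qed.

Lemma vertex_list_sub v : v \in s -> P v.
Proof. by rewrite Pconv => vs; exact: sub_conv_hull. Qed.

Lemma valid_face c (b : R) : (forall y, y \in s -> dot c y <= b) ->
  is_face P (conv_hull [set` [seq y <- s | dot c y == b]]).
Proof.
move=> valid; exists c, b; split; last by rewrite -(conv_face us valid) Pconv.
by rewrite Pconv; apply: conv_hull_dot_le.
Qed.

Lemma valid_faceE c (b : R) : (forall y, y \in s -> dot c y <= b) ->
  conv_hull [set` [seq y <- s | dot c y == b]] = P `&` [set x | dot c x = b].
Proof. by move=> valid; rewrite -(conv_face us valid) Pconv. Qed.

Lemma faceP F : is_face P F -> exists c (b : R),
  [/\ forall y, y \in s -> dot c y <= b, forall y, y \in s -> (F y <-> dot c y = b),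
      F = P `&` [set x | dot c x = b] &
      F = conv_hull [set` [seq y <- s | dot c y == b]]].
Proof.
case=> c [b [valid FE]]; exists c, b.
have val y : y \in s -> dot c y <= b by move/vertex_list_sub/valid.
split=> //; last by rewrite -(conv_face us val) -Pconv.
by move=> y /vertex_list_sub Py; rewrite FE; split=> [[]|].
Qed.

Lemma face_sub F : is_face P F -> F `<=` P.
Proof. by case=> c [b [_ ->]] x []. Qed.

Lemma face_refl : is_face P P.
Proof.
exists 0, 0; split=> [x _|]; first by rewrite [X in X <= _]dot0l.
by apply/seteqP; split=> x; [move=> Px; split=> //; exact: dot0l|case].
Qed.

Definition face_list F := [seq y <- s | `[< F y >]].

Lemma mem_face_list F y : (y \in face_list F) = (y \in s) && `[< F y >].
Proof. by rewrite mem_filter andbC. Qed.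

Lemma face_listP F y : y \in face_list F <-> y \in s /\ F y.
Proof.
by rewrite mem_face_list; split=> [/andP[? /asboolP]|[-> /asboolP]].
Qed.

Lemma face_conv F : is_face P F -> F = conv_hull [set` face_list F].
Proof.
move=> /faceP[c [b [valid Fy _ FE]]]; rewrite [LHS]FE.
suff -> : face_list F = [seq y <- s | dot c y == b] by [].
apply: eq_in_filter => y ys; apply/asboolP/eqP; first by move/(Fy _ ys).
by move=> yb; apply/(Fy _ ys).
Qed.

(** Add to the functional of G a large multiple of the functional of F; the
    finitely many vertices outside F then drop below the bound. *)
Lemma face_trans F G : is_face P F -> is_face F G -> is_face P G.
Proof.
move=> /faceP[c [b [valid Fy FE Fc]]] [c' [b' [valid' GE]]].
have [t ht] : exists t : R, forall y, y \in s -> dot c y < b ->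
    dot c' y - b' + t * (dot c y - b) < 0.
  have [nil|ne] := eqVneq [seq y <- s | dot c y < b] [::].
    exists 0 => y ys yb; suff : y \in [::] by [].
    by rewrite -nil mem_filter yb.
  have [|t ht _] := tightening (g := fun y => dot c y - b)
    (fun y => dot c' y - b') ne.
    by move=> y; rewrite mem_filter subr_lt0 => /andP[].
  exists (t + 1) => y ys yb; have := ht y; rewrite mem_filter yb ys => /(_ isT).
  lra.
have E y : dot (c' + t *: c) y - (b' + t * b) =
    dot c' y - b' + t * (dot c y - b) by rewrite dotDl dotZl; ring.
have valid'' y : y \in s -> dot (c' + t *: c) y <= b' + t * b.
  move=> ys; rewrite -subr_le0 E; have := valid _ ys.
  rewrite le_eqVlt => /predU1P[yb|yb]; last by rewrite ltW ?ht.
  by rewrite yb subrr mulr0 addr0 subr_le0; apply/valid'/Fy.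
have -> : G = conv_hull [set` [seq y <- s | dot (c' + t *: c) y == b' + t * b]].
  rewrite GE Fc conv_face ?filter_uniq // => [|y]; last first.
    by rewrite mem_filter => /andP[/eqP yb ys]; apply/valid'/Fy.
  rewrite -filter_predI.
  suff -> : [seq y <- s | predI (fun y => dot c' y == b') (fun y => dot c y == b) y] =
    [seq y <- s | dot (c' + t *: c) y == b' + t * b] by [].
  apply: eq_in_filter => y ys /=.
  rewrite -[in RHS]subr_eq0 E; have := valid _ ys.
  rewrite le_eqVlt => /predU1P[yb|yb].
    by rewrite yb eqxx andbT subrr mulr0 addr0 subr_eq0.
  by rewrite [RHS]lt_eqF ?ht // (lt_eqF yb) andbF.
exact: valid_face.
Qed.

Lemma sub_face F G : is_face P G -> G `<=` F -> F `<=` P -> is_face F G.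
Proof.
case=> c [b [valid GE]] GF FP; exists c, b; split=> [x /FP/valid //|].
rewrite eqEsubset; split=> x; last by case=> /FP Px xb; rewrite GE.
by move=> Gx; split; [exact: GF|move: Gx; rewrite GE => -[]].
Qed.

Lemma face_vertex_list F : is_face P F -> vertex_list F (face_list F).
Proof.
move=> fF; split; [exact: filter_uniq|exact: face_conv|].
apply/seteqP; split=> v.
  move=> fv; have Fv : F v by case: fv => c [b [_ e]]; have : [set v] v by []; rewrite e => -[].
  by apply/face_listP; split=> //; apply/vertexP; exact: face_trans fv.
move=> /face_listP[/vertexP fv Fv]; apply: sub_face fv _ (face_sub fF).
by move=> _ ->.
Qed.

Lemma face_eq F G : is_face P F -> is_face P G ->
  (forall y, y \in s -> (F y <-> G y)) -> F = G.
Proof.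
move=> fF fG e; rewrite (face_conv fF) (face_conv fG).
suff -> : face_list F = face_list G by [].
by apply: eq_in_filter => y ys; apply/asboolP/asboolP => /(e _ ys).
Qed.

Lemma face_subP F A : is_face P F -> @convex_set R V A ->
  (forall y, y \in s -> F y -> A y) -> F `<=` A.
Proof.
move=> fF cA h; rewrite (face_conv fF); apply: conv_hull_sub => //.
by move=> y /face_listP[]; exact: h.
Qed.

Lemma vertex_expose u : u \in s ->
  exists c, forall v, v \in s -> v != u -> dot c v < dot c u.
Proof.
move=> uS; have /vertexP/faceP[c [b [valid uy _ _]]] := uS.
have ub : dot c u = b by apply/(uy u uS).
exists c => v vs vu; rewrite lt_neqAle ub valid // andbT.
by apply: contraNneq vu => /(uy v vs) ->.
Qed.

Lemma hull_vertex u t : u \in s -> uniq t -> {subset t <= s} ->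
  conv_hull [set` t] u -> u \in t.
Proof.
move=> uS ut ts hu; have [c cs] := vertex_expose uS.
apply: contraPT hu => unt.
have strict v : v \in t -> dot c v < dot c u.
  by move=> vt; apply: cs (ts _ vt) _; apply: contraNneq unt => <-.
have := conv_face ut (fun v vt => ltW (strict v vt)).
rewrite (_ : [seq _ <- _ | _] = [::]) => [|]; last first.
  by apply/eqP; rewrite -[_ == _]negbK -has_filter; apply/hasPn => v /strict/lt_eqF ->.
by rewrite conv_hull_nil => e hu; have : set0 u by rewrite -e.
Qed.

Lemma vertex_list_nonempty d : has_dim P d -> exists u, u \in s.
Proof.
move=> /has_dim_nonempty; rewrite Pconv.
case: s => [|u s']; first by rewrite conv_hull_nil => -[].
by exists u; rewrite mem_head.
Qed.

Lemma vertex_list_dimP u d : u \in s -> has_dim P d <-> \dim (dirs u s) = d.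
Proof. by rewrite Pconv; exact: has_dimP. Qed.

Lemma vertex_list_dim_uniq d e : has_dim P d -> has_dim P e -> d = e.
Proof.
move=> hd he; have [u uS] := vertex_list_nonempty hd.
by move: hd he => /(vertex_list_dimP _ uS) <- /(vertex_list_dimP _ uS) <-.
Qed.

Lemma vertex_list_has_dim u : u \in s -> exists d, has_dim P d.
Proof. by move=> uS; exists (\dim (dirs u s)); apply/(vertex_list_dimP _ uS). Qed.

(** The list minus one of its points u spans all directions from u. *)
Lemma size_vertex_list d : has_dim P d -> (d < size s)%N.
Proof.
move=> hd; have [u uS] := vertex_list_nonempty hd; move: hd => /(vertex_list_dimP _ uS) <-.
have -> : dirs u s = dirs u (rem u s).
  rewrite /dirs; apply/eqP; rewrite eqEsubv; apply/andP; split.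
    apply/span_subvP => _ /mapP[y ys ->].
    have [->|yu] := eqVneq y u; first by rewrite subrr mem0v.
    by apply: mem_dirs; rewrite mem_rem_uniq // inE yu.
  by apply: sub_span => _ /mapP[y /mem_rem ys ->]; apply: map_f.
apply: leq_ltn_trans (dim_span _) _; rewrite size_map size_rem //.
by rewrite prednK //; case: s uS.
Qed.

End OnePolytope.

(** The functional of F vanishes on the directions of F but not on those
    of P. *)
Lemma face_dim_lt P s F d e : vertex_list P s -> is_face P F ->
  has_dim P d -> has_dim F e -> F <> P -> (e < d)%N.
Proof.
move=> Ps fF hP hF ne; have FsF := face_vertex_list Ps fF.
have [u uF] := vertex_list_nonempty FsF hF.
have [uS Fu] := (face_listP s F u).1 uF.
move: hP hF => /(vertex_list_dimP Ps _ uS) <- /(vertex_list_dimP FsF _ uF) <-.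
have sub : (dirs u (face_list s F) <= dirs u s)%VS.
  by apply: sub_span => _ /mapP[y /face_listP[ys _] ->]; apply: map_f.
rewrite ltn_neqAle dimvS // andbT; apply/negP => /eqP edim.
have /eqP eD : dirs u (face_list s F) == dirs u s by rewrite eqEdim sub edim /=.
have [c [b [valid Fy FE Fc]]] := faceP Ps fF.
apply: ne; apply: (face_eq Ps fF (face_refl P)) => y ys.
split=> [|_]; first by move=> _; exact: (vertex_list_sub Ps).
apply/(Fy _ ys); have := mem_dirs u ys; rewrite -eD.
move/(span_dot0 (c := c)) => h; apply/eqP; rewrite -((Fy u uS).1 Fu) -subr_eq0 -dotB.
apply/eqP/h => z /face_listP[zs /(Fy _ zs) zb].
by rewrite dotB zb ((Fy u uS).1 Fu) subrr.
Qed.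

End Faces.

(** * The cone at a vertex and its edges *)

Lemma card_set_seq (T : eqType) (s : seq T) : uniq s -> [set` s] #= `I_(size s).
Proof.
case: s => [|x0 s0]; first by move=> _; rewrite (_ : [set` _] = set0) ?II0 //; apply/seteqP; split.
set s := x0 :: s0 => us.
have -> : [set` s] = nth x0 s @` `I_(size s).
  apply/seteqP; split=> [x /= xs|_ [i /= ilt <-]]; last exact: mem_nth.
  by exists (index x s); [rewrite -index_mem in xs|exact: nth_index].
by apply: inj_card_eq => i j; rewrite !inE /= => ii jj /eqP; rewrite nth_uniq // => /eqP.
Qed.

Section VertexCones.
Variables (R : realType) (n : nat).
Local Notation V := 'rV[R]_n.
Implicit Types (A B P F G E : set V) (s t es : seq V) (u v x y e : V) (c : 'cV[R]_n).

Definition in_cone u es x :=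
  exists2 l : V -> R, forall e, 0 <= l e & x = \sum_(e <- es) l e *: (e - u).

Definition spans_cone s u es :=
  [/\ uniq es, {subset es <= s}, u \notin es &
      forall y, y \in s -> in_cone u es (y - u)].

(** Irredundant generators of the cone at u chosen among the vertices; they turn
    out to be the neighbours of u, see [card_edges]. *)
Definition cone_basis s u es := spans_cone s u es /\
  forall e, e \in es -> ~ in_cone u (rem e es) (e - u).

Lemma exists_cone_basis s u : uniq s -> exists es, cone_basis s u es.
Proof.
move=> us.
have [|es [ues ess eg min]] := minimal_sublist
  (Q := fun t => forall y, y \in s -> in_cone u t (y - u)) (rem_uniq u us).
  move=> y ys; have [->|yu] := eqVneq y u.
    by exists (fun=> 0) => //; rewrite big1 ?subrr // => i _; rewrite scale0r.
  exists (fun i => (i == y)%:R) => [i|]; first exact: ler0n.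
  rewrite (bigD1_seq y) ?rem_uniq ?mem_rem_uniq // ?inE ?yu //= eqxx scale1r.
  by rewrite big1 ?addr0 // => i /negbTE ->; rewrite scale0r.
exists es; split; [split=> //|].
- by move=> e /ess /mem_rem.
- by apply/negP => /ess; rewrite mem_rem_uniqF.
move=> e ees [k k0 ke]; apply: (min e ees) => y /eg[l l0 ->].
exists (fun i => l i + l e * k i) => [i|]; first by rewrite addr_ge0 // mulr_ge0.
rewrite (perm_big _ (perm_to_rem ees)) big_cons.
under [RHS]eq_bigr do rewrite scalerDl -scalerA.
by rewrite big_split /= -scaler_sumr -ke addrC.
Qed.

Section AtVertex.
Variables (P : set V) (s : seq V) (u : V) (es : seq V).
Hypotheses (Ps : vertex_list P s) (uS : u \in s).

(** Otherwise one of y and e lies strictly between u and the other, which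
    the functional exposing it forbids. *)
Lemma ray_vertex y e (a : R) : y \in s -> e \in s -> e != u -> 0 <= a ->
  y - u = a *: (e - u) -> y = u \/ y = e.
Proof.
move=> ys eS eu a0 ya; apply: contrapT => /not_orP[/eqP yu /eqP ye].
have E c : dot c y - dot c u = a * (dot c e - dot c u) by rewrite -!dotB ya dotZ.
have [a1|a1] := lerP a 1.
  have [c cy] := vertex_expose Ps ys.
  have ap : 0 < a.
    rewrite lt_neqAle a0 andbT; apply: contra_neq yu => a00.
    by apply/eqP; rewrite -subr_eq0 ya -a00 scale0r.
  have := E c; have : 0 < a * (dot c y - dot c e).
    by rewrite mulr_gt0 // subr_gt0 cy // eq_sym.
  have : 0 <= (1 - a) * (dot c y - dot c u).
    by rewrite mulr_ge0 ?subr_ge0 // ltW // cy // eq_sym.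
  lra.
have [c ce] := vertex_expose Ps eS; have := E c.
have : 0 < (a - 1) * (dot c e - dot c u) by rewrite mulr_gt0 ?subr_gt0 // ce // eq_sym.
have := ce y ys ye; lra.
Qed.

Lemma cone_dot_le c (b : R) : spans_cone s u es -> dot c u = b ->
  (forall e, e \in es -> dot c e <= b) -> forall y, y \in s -> dot c y <= b.
Proof.
move=> [_ _ _ eg] ub le y /eg[l l0 /(congr1 (dot c))].
rewrite dotB dot_sum ub => ye; rewrite -subr_le0 ye big_seq sumr_le0 // => e ees.
by rewrite mulr_ge0_le0 // dotB ub subr_le0 le.
Qed.

(** The functional of F is at most its bound on all generators and equal to it
    at y and u, so y only uses generators on which it is tight. *)
Lemma face_cone F : spans_cone s u es -> is_face P F -> F u ->
  spans_cone (face_list s F) u (face_list es F).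
Proof.
move=> [ues ess ue eg] fF Fu; have [c [b [valid Fy _ _]]] := faceP Ps fF.
have ub : dot c u = b by apply/(Fy _ uS).
split; first exact: filter_uniq.
- by move=> e; rewrite !mem_face_list => /andP[/ess -> ->].
- by rewrite mem_face_list (negbTE ue).
move=> y /face_listP[ys /(Fy _ ys) yb]; have [l l0 ye] := eg y ys.
exists l => //; rewrite ye big_filter [RHS]big_mkcond.
apply: eq_big_seq => e ees; case: asboolP => // nFe.
have : \sum_(e <- es) l e * (b - dot c e) = 0.
  have := congr1 (dot c) ye; rewrite dot_sum dotB yb ub subrr => /esym/(congr1 -%R).
  rewrite oppr0 -sumrN => z0; rewrite -[RHS]z0; apply: eq_bigr => f _.
  by rewrite dotB ub -mulrN opprB.
rewrite big_seq => /eqP; rewrite psumr_eq0; last first.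
  by move=> f fes; rewrite mulr_ge0 // subr_ge0 valid // ess.
move=> /allP/(_ e ees); rewrite ees /= mulf_eq0 subr_eq0 => /orP[/eqP ->|/eqP eb].
  exact: scale0r.
by case: nFe; apply/(Fy _ (ess _ ees)).
Qed.

Lemma sub_spans_face F t y : is_face P F -> F u -> {subset t <= s} ->
  (forall e, e \in t -> F e) -> y \in s -> in_cone u t (y - u) -> F y.
Proof.
move=> fF Fu ts tF ys [l l0 ye]; have [c [b [valid Fy _ _]]] := faceP Ps fF.
have ub : dot c u = b by apply/(Fy _ uS).
apply/(Fy _ ys)/eqP; rewrite -ub -subr_eq0 -dotB ye dot_sum big_seq big1 // => e et.
by rewrite dotB ((Fy e (ts _ et)).1 (tF e et)) ub subrr mulr0.
Qed.

Lemma spans_dirs : spans_cone s u es -> dirs u s = dirs u es.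
Proof.
move=> [_ ess _ eg]; apply/eqP; rewrite eqEsubv; apply/andP; split; last first.
  by apply: sub_span => _ /mapP[y /ess ys ->]; apply: map_f.
apply/span_subvP => _ /mapP[y /eg[l _ ->] ->]; rewrite big_seq.
by apply: memv_suml => e ees; apply: memvZ; exact: mem_dirs.
Qed.

Lemma has_dim_segment e : e != u -> has_dim (conv_hull [set` [:: u; e]]) 1.
Proof.
move=> eu; apply/(has_dimP (u := u)); first by rewrite mem_head.
have /eqP l0 : <[0 : V]>%VS == 0%VS by rewrite -dimv_eq0 dim_vline eqxx.
by rewrite /dirs /= subrr span_cons span_seq1 l0 add0v dim_vline subr_eq0 eu.
Qed.

(** Strict separation of the other generators from the line through u and e.
    If it failed, a combination of the other generators would lie on that line:
    either on the ray towards e, against irredundancy, or on the opposite ray,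
    against u being a vertex. *)
Lemma basis_edge e : cone_basis s u es -> e \in es ->
  is_face P (conv_hull [set` [:: u; e]]).
Proof.
move=> [sp min] ees; have [ues ess ue eg] := sp.
have eS := ess _ ees; have eu : e != u by apply: contraNneq ue => <-.
have remE f : (f \in rem e es) = (f != e) && (f \in es).
  by rewrite mem_rem_uniq // inE.
have [[l l0 [/vlineP[k lk] [i ie li]]]|[c cW cs]] :=
    farkas_strict <[e - u]>%VS (fun f => f - u) (rem_uniq e ues).
  have [c cu] := vertex_expose Ps uS.
  have cneg f : f \in es -> dot c f - dot c u < 0.
    move=> fes; rewrite subr_lt0 cu ?ess //; by apply: contraNneq ue => <-.
  have neg f : f \in rem e es -> l f * dot c (f - u) <= 0.
    by move=> /mem_rem fes; rewrite mulr_ge0_le0 // dotB ltW // cneg.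
  have kp : 0 < k.
    have : \sum_(f <- rem e es) l f * dot c (f - u) < 0.
      rewrite (bigD1_seq i) ?rem_uniq //= -[ltRHS]addr0 ltr_leD //.
        by rewrite dotB pmulr_rlt0 // cneg // (mem_rem ie).
      by rewrite big_seq_cond sumr_le0 // => f /andP[/neg].
    rewrite -dot_sum lk dotZ dotB => h; rewrite ltNge; apply/negP => k0; move: h.
    by rewrite ltNge mulr_le0 // ltW // cneg.
  case: (min e ees); exists (fun f => l f / k) => [f|]; first by rewrite divr_ge0 // ltW.
  under eq_bigr do rewrite mulrC -scalerA.
  by rewrite -scaler_sumr lk scalerA mulVf ?gt_eqF // scale1r.
have ce : dot c e = dot c u by apply/eqP; rewrite -subr_eq0 -dotB cW // memv_line.
have lt f : f \in es -> f != e -> dot c f < dot c u.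
  by move=> fes fe; rewrite -subr_lt0 -dotB cs // remE fe.
have le f : f \in es -> dot c f <= dot c u.
  by move=> fes; have [->|/(lt _ fes)/ltW //] := eqVneq f e; rewrite ce.
have valid := cone_dot_le sp erefl le.
have := valid_face Ps valid; congr (is_face P (conv_hull _)).
apply/seteqP; split=> y /=; rewrite mem_filter !inE; last first.
  by move=> /orP[]/eqP ->; rewrite ?ce eqxx.
move=> /andP[/eqP yb ys].
have [l l0] : in_cone u [:: e] (y - u).
  have [l l0 ye] := eg y ys; exists l => //.
  rewrite big_seq1 ye (perm_big _ (perm_to_rem ees)) big_cons /=.
  suff h f : f \in rem e es -> l f = 0.
    by rewrite big_seq big1 ?addr0 // => f /h ->; rewrite scale0r.
  have : \sum_(f <- es) l f * (dot c u - dot c f) = 0.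
    have := congr1 (dot c) ye; rewrite dot_sum dotB yb subrr => /esym/(congr1 -%R).
    rewrite oppr0 -sumrN => z0; rewrite -[RHS]z0; apply: eq_bigr => g _.
    by rewrite dotB -mulrN opprB.
  rewrite big_seq => /eqP; rewrite psumr_eq0; last first.
    by move=> g ges; rewrite mulr_ge0 // subr_ge0 le.
  move=> /allP h; rewrite remE => /andP[fe fes]; have := h f fes.
  by rewrite fes /= mulf_eq0 subr_eq0 (gt_eqF (lt _ fes fe)) orbF => /eqP.
rewrite big_seq1 => ye; have [->|->] := ray_vertex ys eS eu (l0 e) ye.
  by rewrite eqxx.
by rewrite eqxx orbT.
Qed.

(** The edges at u are the segments from u to its generators: an edge contains
    a generator by [face_cone], and has no room for more. *)
Lemma card_edges : cone_basis s u es ->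
  [set E | is_edge P E /\ E u] #= `I_(size es).
Proof.
move=> bas; have [sp min] := bas; have [ues ess ue eg] := sp.
have neu e : e \in es -> e != u by move=> ees; apply: contraNneq ue => <-.
pose seg e := conv_hull [set` [:: u; e]].
have -> : [set E | is_edge P E /\ E u] = seg @` [set` es].
  apply/seteqP; split=> [E [[fE dE] Eu]|_ [e /= ees <-]]; last first.
    split; last by apply: sub_conv_hull; rewrite /= mem_head.
    by split; [exact: basis_edge|apply: has_dim_segment; exact: neu].
  have EsE := face_vertex_list Ps fE.
  have uE : u \in face_list s E by apply/face_listP.
  have [e ee] : exists e, e \in face_list es E.
    case h : (face_list es E) => [|e ?]; last by exists e; rewrite mem_head.
    have := (vertex_list_dimP EsE _ uE).1 dE; rewrite (_ : dirs _ _ = 0%VS) ?dimv0 //.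
    apply/eqP; rewrite -subv0; apply/span_subvP => w /mapP[y].
    have [_ _ _ gen] := face_cone sp fE Eu.
    by move=> /gen; rewrite h => -[l _ ->] ->; rewrite big_nil mem0v.
  move: ee => /face_listP[ees Ee]; exists e => //.
  have cE : @convex_set R V E by rewrite (face_conv Ps fE); exact: conv_hull_convex.
  have sub : seg e `<=` E.
    by apply: conv_hull_sub => // y /=; rewrite !inE => /orP[]/eqP ->.
  apply: contrapT => ne.
  have := face_dim_lt EsE (sub_face (basis_edge bas ees) sub (face_sub fE)) dE
    (has_dim_segment (neu _ ees)) ne.
  by rewrite ltnn.
apply: card_eq_trans (card_set_seq ues); apply: inj_card_eq => e f.
rewrite !inE /= => ees fes ef.
have : seg e f by rewrite ef; apply: sub_conv_hull; rewrite /= !inE eqxx orbT.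
move=> /(hull_vertex Ps (ess _ fes)) h.
have : f \in [:: u; e].
  apply: h; first by rewrite /= inE eq_sym neu.
  by move=> y; rewrite !inE => /orP[]/eqP -> //; exact: ess.
by rewrite !inE (negbTE (neu _ fes)) /= => /eqP.
Qed.

Lemma is_simpleP d : cone_basis s u es -> is_simple d P u <-> size es = d.
Proof.
move=> /card_edges c; split=> [sd|<- //]; apply/card_eq_II.
by apply: card_eq_trans sd; rewrite card_eq_sym.
Qed.

Lemma spans_free d : spans_cone s u es -> has_dim P d -> size es = d ->
  free [seq e - u | e <- es].
Proof.
move=> sp /(vertex_list_dimP Ps _ uS); rewrite (spans_dirs sp) => h se.
by rewrite /free size_map se -h.
Qed.

Lemma free_basis : spans_cone s u es -> free [seq e - u | e <- es] ->
  cone_basis s u es.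
Proof.
move=> sp fr; split=> // e ees [l l0 el]; have [ues ess ue eg] := sp.
have : \dim (dirs u es) = size es by rewrite (eqP fr) size_map.
have -> : dirs u es = dirs u (rem e es).
  apply/eqP; rewrite eqEsubv; apply/andP; split; last first.
    by apply: sub_span => _ /mapP[y /mem_rem ys ->]; apply: map_f.
  apply/span_subvP => _ /mapP[y ys ->]; have [->|ye] := eqVneq y e; last first.
    by apply: mem_dirs; rewrite mem_rem_uniq // inE ye.
  by rewrite el big_seq; apply: memv_suml => f fes; apply: memvZ; exact: mem_dirs.
have := dim_span [seq f - u | f <- rem e es]; rewrite size_map size_rem //.
rewrite -/(dirs _ _) => /[swap] ->; case: (es) ees => //= a q _.
by rewrite ltnn.
Qed.

End AtVertex.

Lemma simple_basis P s u d : vertex_list P s -> u \in s -> has_dim P d ->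
  is_simple d P u ->
  exists es, [/\ spans_cone s u es, size es = d & free [seq e - u | e <- es]].
Proof.
move=> Ps uS hd sd; have us : uniq s by case: Ps.
have [es bas] := exists_cone_basis u us.
have se := (is_simpleP Ps uS d bas).1 sd; case: (bas) => sp _.
by exists es; split=> //; apply: spans_free Ps uS _ sp hd se.
Qed.

(** The generators of the cone of F at u are those of P that lie in F, and they
    remain independent, so their number is the dimension of F. *)
Lemma simple_face P s u es F f : vertex_list P s -> u \in s -> spans_cone s u es ->
  free [seq e - u | e <- es] -> is_face P F -> F u -> has_dim F f ->
  is_simple f F u /\ size (face_list es F) = f.
Proof.
move=> Ps uS sp fr fF Fu hF.
have spF := face_cone Ps uS sp fF Fu; have FsF := face_vertex_list Ps fF.
have uF : u \in face_list s F by apply/face_listP.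
have frF : free [seq e - u | e <- face_list es F].
  rewrite (_ : map _ _ = [seq w <- [seq e - u | e <- es] | `[< F (w + u) >]]).
    exact: filter_free.
  by rewrite filter_map; congr map; apply: eq_filter => e /=; rewrite subrK.
have bF := free_basis spF frF.
have sF : size (face_list es F) = f.
  move: hF => /(vertex_list_dimP FsF _ uF) <-; rewrite (spans_dirs spF).
  by rewrite (eqP frF) size_map.
split=> //; exact: (is_simpleP FsF uF f bF).2.
Qed.

Lemma simple_in_face P s u d F f : vertex_list P s -> u \in s -> has_dim P d ->
  is_simple d P u -> is_face P F -> F u -> has_dim F f -> is_simple f F u.
Proof.
move=> Ps uS hd su fF Fu hF; have [es [sp _ fr]] := simple_basis Ps uS hd su.
by have [] := simple_face Ps uS sp fr fF Fu hF.
Qed.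

End VertexCones.

(** * Facets *)

Section Facets.
Variables (R : realType) (n : nat).
Local Notation V := 'rV[R]_n.
Implicit Types (A B P F G K : set V) (s t es : seq V) (u v x y o : V) (c : 'cV[R]_n).

Lemma facet_face P F : is_facet P F -> is_face P F.
Proof. by case=> d []. Qed.

Lemma facetP P s d F : vertex_list P s -> has_dim P d.+1 ->
  is_facet P F <-> is_face P F /\ has_dim F d.
Proof.
move=> Ps hd; split=> [[e [he fF hF]]|[fF hF]]; last by exists d.
by have [->] := vertex_list_dim_uniq Ps hd he.
Qed.

(** Tilt the hyperplane of F about K until it meets a vertex outside F. *)
Lemma other_facet P s F K : vertex_list P s -> is_facet P F -> is_facet F K ->
  exists G, [/\ is_facet P G, G <> F & G `&` F = K].
Proof.
move=> Ps [d' [hP fF hF]] [d [hF' fK hK]]; have FsF := face_vertex_list Ps fF.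
have e := vertex_list_dim_uniq FsF hF hF'; subst d'.
have [c [b [valid Fy FE Fc]]] := faceP Ps fF.
have [c' [b' [valid' Ky KE Kc]]] := faceP FsF fK.
pose s' := [seq y <- s | dot c y < b].
have FnP : F <> P.
  move=> FP; move: hP; rewrite -FP => hF''.
  by have /eqP := vertex_list_dim_uniq FsF hF'' hF'; rewrite eqn_leq ltnn.
have s'N : s' != [::].
  apply: contra_notN FnP => /eqP s'0.
  apply: (face_eq Ps fF (face_refl P)) => y ys; split=> _; first exact: vertex_list_sub Ps _ ys.
  apply/(Fy _ ys)/eqP; rewrite eq_le valid //= leNgt; apply/negP => yb.
  by have : y \in s'; [rewrite mem_filter yb|rewrite s'0].
(* the tilted functional c' + t c is tight on K and at the vertex i *)
have [|t ht [i is' it]] := tightening (g := fun y => dot c y - b)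
  (fun y => dot c' y - b') s'N.
  by move=> y; rewrite mem_filter subr_lt0 => /andP[].
have E y : dot (c' + t *: c) y - (b' + t * b) =
    dot c' y - b' + t * (dot c y - b) by rewrite dotDl dotZl; ring.
have valid'' y : y \in s -> dot (c' + t *: c) y <= b' + t * b.
  move=> ys; rewrite -subr_le0 E; have := valid _ ys.
  rewrite le_eqVlt => /predU1P[yb|yb]; last by apply: ht; rewrite mem_filter yb.
  rewrite yb subrr mulr0 addr0 subr_le0; apply/valid'/face_listP.
  by split=> //; apply/Fy.
pose G := conv_hull [set` [seq y <- s | dot (c' + t *: c) y == b' + t * b]].
have fG : is_face P G by exact: valid_face.
have GE : G = P `&` [set x | dot (c' + t *: c) x = b' + t * b].
  exact: valid_faceE.
have GF : G `&` F = K.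
  rewrite GE KE; apply/seteqP; split=> x /=.
    case=> -[Px] /eqP; rewrite -subr_eq0 E => /eqP xb Fx; split=> //.
    move: Fx xb; rewrite FE => -[_ /= ->]; rewrite subrr mulr0 addr0.
    by move/eqP; rewrite subr_eq0 => /eqP.
  case=> Fx xb; split=> //; split; first exact: (face_sub fF).
  apply/eqP; rewrite -subr_eq0 E xb; move: Fx; rewrite FE => -[_ /= ->].
  by rewrite !subrr mulr0 addr0.
have KG : K `<=` G by rewrite -GF => x [].
have GsG := face_vertex_list Ps fG.
move: is'; rewrite mem_filter => /andP[ib iS].
have Gi : G i.
  by rewrite GE; split; [exact: vertex_list_sub Ps _ iS|apply/eqP; rewrite -subr_eq0 E it].
have nFi : ~ F i by rewrite FE => -[_ /= ib']; rewrite ib' ltxx in ib.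
have [g hG] := vertex_list_has_dim GsG ((face_listP _ _ _).2 (conj iS Gi)).
have KnG : K <> G by move=> KG'; apply: nFi; move: Gi; rewrite -KG' -GF => -[].
have GnF : G <> F by move=> GF'; apply: nFi; rewrite -GF'.
have GnP : G <> P.
  move=> GP; have KF : K = F.
    by rewrite -GF GP; apply/seteqP; split=> x; [case|move=> Fx; split=> //; exact: (face_sub fF)].
  move: hK; rewrite KF => hF''.
  by have /eqP := vertex_list_dim_uniq FsF hF'' hF'; rewrite eqn_leq ltnn andbF.
have lo := face_dim_lt GsG (sub_face (face_trans Ps fF fK) KG (face_sub fG)) hG hK KnG.
have hi := face_dim_lt Ps fG hP hG GnP.
exists G; split=> //; exists d.+1; split=> //.
by rewrite (_ : d.+1 = g) //; apply/eqP; rewrite eqn_leq lo /=.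
Qed.

(** A facet through a simple vertex u misses exactly one neighbour of u and is
    determined by it, so the neighbour missed by F lies on all others. *)
Lemma simple_outer P s u d F : vertex_list P s -> u \in s -> has_dim P d ->
  is_simple d P u -> is_facet P F -> F u ->
  exists o, [/\ o \in s, ~ F o &
    forall G, is_facet P G -> G <> F -> G u -> G o].
Proof.
move=> Ps uS hd sd fcF Fu.
have [es [sp se fr]] := simple_basis Ps uS hd sd.
have cnt G : is_facet P G -> G u -> (size (face_list es G)).+1 = size es.
  case=> e [he fG hG] Gu; rewrite se (vertex_list_dim_uniq Ps hd he).
  by have [_ ->] := simple_face Ps uS sp fr fG Gu hG.
have [ues ess ue _] := sp.
have miss G : is_facet P G -> G u -> exists2 o, o \in es & ~ G o /\
    (forall e, e \in es -> e != o -> G e).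
  move=> fcG Gu; have := cnt G fcG Gu; rewrite size_filter.
  rewrite -(count_predC (fun e => `[< G e >]) es) -addn1 => /addnI/esym.
  rewrite -size_filter; case E : [seq e <- es | _] => [|o [|//]] //= _.
  have memE e : (e \in es) && ~~ `[< G e >] = (e == o).
    by rewrite -[RHS]inE -E mem_filter andbC.
  have := memE o; rewrite eqxx => /andP[oes /asboolP nGo].
  exists o => //; split=> // e ees eo; apply/asboolP/negPn.
  by have := memE e; rewrite ees /= => ->.
have [o oes [nFo Fe]] := miss F fcF Fu; exists o; split=> //; first exact: ess.
move=> G fcG GF Gu; apply: contrapT => nGo; apply: GF.
have [o' o'es [nGo' Ge]] := miss G fcG Gu.
have oo' : o = o' by apply: contra_notP nGo => /eqP; exact: Ge.
have eqL : face_list es F = face_list es G.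
  apply: eq_in_filter => e ees; have [->|eo] := eqVneq e o; first by rewrite !asboolF.
  by rewrite (asboolT (Fe e ees eo)) asboolT //; apply: Ge; rewrite -?oo'.
have fF := facet_face fcF; have fG := facet_face fcG.
have sub A : {subset face_list es A <= s} by move=> e /face_listP[/ess].
apply: (face_eq Ps fG fF) => y ys; split=> [Gy|Fy].
  have [_ _ _ gen] := face_cone Ps uS sp fG Gu.
  apply: (sub_spans_face Ps uS fF Fu (sub F) _ ys); first by move=> e /face_listP[].
  by rewrite eqL; apply: gen; apply/face_listP.
have [_ _ _ gen] := face_cone Ps uS sp fF Fu.
apply: (sub_spans_face Ps uS fG Gu (sub G) _ ys); first by move=> e /face_listP[].
by rewrite -eqL; apply: gen; apply/face_listP.
Qed.

Lemma has_another s (d : nat) u : (d.+1 < size s)%N -> uniq s ->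
  exists2 v, v \in s & v != u.
Proof.
move=> lt us; apply: contrapT => h; have : {subset s <= [:: u]}.
  by move=> y ys; rewrite inE; apply: contrapT => /negP yu; apply: h; exists y.
by move/(uniq_leq_size us); rewrite leqNgt (leq_ltn_trans _ lt).
Qed.

(** Choose another vertex q.  The direction q - u points out of the cone at q,
    so some facet of this cone separates the two, and u is off that facet. *)
Lemma facet_avoiding P s d u : vertex_list P s -> has_dim P d.+1 -> u \in s ->
  exists2 F, is_facet P F & ~ F u.
Proof.
move=> Ps hd uS; have us : uniq s by case: Ps.
have [q qs qu] := has_another u (size_vertex_list Ps hd) us.
have [||c [valid pos dimT]] := farkas_facet (a := fun y => y - q) (x := q - u) us.
- by rewrite -memvN opprB; exact: mem_dirs.
- case=> l l0 /eqP; have [c cs] := vertex_expose Ps qs => /eqP/(congr1 (dot c)).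
  rewrite dot_sum dotB => e; have : 0 < dot c q - dot c u.
    by rewrite subr_gt0 cs // eq_sym.
  rewrite e big_seq ltNge sumr_le0 // => y ys; rewrite mulr_ge0_le0 // dotB subr_le0.
  by have [->//|/(cs _ ys)/ltW] := eqVneq y q.
have val y : y \in s -> dot c y <= dot c q.
  by move=> ys; rewrite -subr_le0 -dotB valid.
pose F := conv_hull [set` [seq y <- s | dot c y == dot c q]].
have FE : F = P `&` [set x | dot c x = dot c q] by exact: valid_faceE.
have fF : is_face P F by exact: valid_face.
have qF : q \in face_list s F.
  by apply/face_listP; split=> //; rewrite FE; split=> //; exact: vertex_list_sub Ps _ qs.
exists F; last by rewrite FE => -[_ /= e]; rewrite dotB e subrr ltxx in pos.
apply/(facetP _ Ps hd); split=> //; apply/(vertex_list_dimP (face_vertex_list Ps fF) _ qF).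
have := (vertex_list_dimP Ps _ qs).1 hd; rewrite /dirs -dimT => -[<-].
congr (\dim <<map _ _>>); apply: eq_in_filter => y ys.
rewrite dotB subr_eq0; apply/asboolP/eqP => [|e]; rewrite FE; first by case.
by split=> //; exact: vertex_list_sub Ps _ ys.
Qed.

(** Seen from o there is one more direction than within s, that of k - o:
    c vanishes on the directions within s but not on it. *)
Lemma dirs_cone c (b : R) o k s : k \in s -> (forall y, y \in s -> dot c y = b) ->
  dot c o <> b -> \dim (dirs o s) = (\dim (dirs k s)).+1.
Proof.
move=> ks sb ob; have -> : dirs o s = (<[k - o]> + dirs k s)%VS.
  apply/eqP; rewrite eqEsubv; apply/andP; split.
    apply/span_subvP => _ /mapP[y ys ->].
    have -> : y - o = (k - o) + (y - k) by rewrite [RHS]addrC addrA subrK.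
    by apply: memv_add; [exact: memv_line|exact: mem_dirs].
  rewrite subv_add; apply/andP; split; first by rewrite -memvE; exact: mem_dirs.
  apply/span_subvP => _ /mapP[y ys ->].
  have -> : y - k = (y - o) - (k - o) by rewrite opprB addrA subrK.
  by apply: memvB; exact: mem_dirs.
have ko : k - o != 0.
  by rewrite subr_eq0; apply/eqP => e; apply: ob; rewrite -e sb.
rewrite dimv_disjoint_sum ?dim_vline ?ko //.
apply/eqP; rewrite -subv0; apply/subvP => w /memv_capP[/vlineP[a ->] kd].
have : dot c (a *: (k - o)) = 0.
  by apply: span_dot0 kd => y ys; rewrite dotB !sb // subrr.
rewrite dotZ dotB sb // => /eqP; rewrite mulf_eq0 subr_eq0 => /orP[/eqP ->|].
  by rewrite scale0r mem0v.
by rewrite eq_sym => /eqP.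
Qed.

(** Suppose y is a further vertex.  Then y - o is outside the cone generated by
    F - o, because y is not in the hull of F and o.  So y violates a facet of
    that cone, which meets F in a facet K of F.  The facet G of P through K and o
    spans the same hyperplane, hence y violates its inequality as well. *)
Lemma pyramid_of_common_apex P s d F o : vertex_list P s -> has_dim P d.+2 ->
  is_facet P F -> o \in s -> ~ F o ->
  (forall K, is_facet F K -> exists G, [/\ is_facet P G, K `<=` G, G <> F & G o]) ->
  forall y, y \in s -> F y \/ y = o.
Proof.
move=> Ps hd fcF os nFo adj y ys; apply: contrapT => /not_orP[nFy yo].
have us : uniq s by case: Ps.
have [fF hF] := (facetP F Ps hd).1 fcF.
have FsF := face_vertex_list Ps fF; have usF : uniq (face_list s F) by case: FsF.
have [c [b [valid Fy FE _]]] := faceP Ps fF.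
have lt z : z \in s -> ~ F z -> dot c z < b.
  by move=> zs nFz; rewrite lt_neqAle valid // andbT; apply: contra_notN nFz => /eqP/(Fy _ zs).
have sFb z : z \in face_list s F -> dot c z = b by move=> /face_listP[zs /(Fy _ zs)].
have [k kF] := vertex_list_nonempty FsF hF.
have dimo : \dim (dirs o (face_list s F)) = d.+2.
  rewrite (dirs_cone kF sFb (o := o)); first by congr _.+1; exact/(vertex_list_dimP FsF _ kF).
  by move/(Fy _ os).
have dirsE : dirs o s = dirs o (face_list s F).
  apply/esym/eqP; rewrite eqEdim dimo ((vertex_list_dimP Ps _ os).1 hd) leqnn andbT.
  by apply: sub_span => _ /mapP[z /face_listP[zs _] ->]; apply: map_f.
have [||c1 [valid1 pos dimT]] :=
    farkas_facet (a := fun z => z - o) (x := y - o) usF.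
- by rewrite -/(dirs o _) -dirsE; exact: mem_dirs.
- (* y would lie in the pyramid over F with apex o *)
  case=> l l0 yl; set L := \sum_(z <- face_list s F) l z.
  have : dot c y - dot c o = L * (b - dot c o).
    rewrite -dotB yl dot_sum mulr_suml; apply: eq_big_seq => z /sFb zb.
    by rewrite dotB zb.
  move=> hL; have ltL : L < 1.
    have : 0 < (1 - L) * (b - dot c o).
      by rewrite mulrBl mul1r -hL; have := lt y ys nFy; lra.
    by rewrite pmulr_lgt0 subr_gt0 // lt.
  have : y \in o :: face_list s F.
    apply: (hull_vertex Ps ys); first by rewrite /= usF andbT; apply/negP => /face_listP[].
      by move=> z; rewrite inE => /predU1P[->//|/face_listP[]].
    apply: (@conv_cone _ _ _ o y (fun z => if z == o then 1 - L else l z)).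
    + by move=> z; case: ifP => // _; rewrite subr_ge0 ltW.
    + rewrite big_cons eqxx -[RHS](subrK L); congr (_ + _).
      apply: eq_big_seq => z zF; case: eqP => // zo.
      by case: nFo; move: zF; rewrite zo => /face_listP[].
    rewrite big_cons subrr scaler0 add0r yl; apply: eq_big_seq => z zF.
    case: eqP => // zo; by case: nFo; move: zF; rewrite zo => /face_listP[].
  by rewrite inE => /predU1P[//|/face_listP[]].
pose T := [seq z <- face_list s F | dot c1 z == dot c1 o].
have TE : [seq z <- face_list s F | dot c1 (z - o) == 0] = T.
  by apply: eq_filter => z; rewrite dotB subr_eq0.
have dimW : \dim (dirs o T) = d.+1.
  by move: dimT; rewrite TE -!/(dirs o _) dimo => -[].
have val1 z : z \in face_list s F -> dot c1 z <= dot c1 o.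
  by move=> /valid1; rewrite dotB subr_le0.
have fK := valid_face FsF val1; have KE := valid_faceE FsF val1.
set K := conv_hull _ in fK KE.
have TK : face_list (face_list s F) K = T.
  apply: eq_in_filter => z zF; apply/asboolP/eqP => [|e]; rewrite KE; first by case.
  by split=> //; exact: vertex_list_sub FsF _ zF.
have KsT := face_vertex_list FsF fK; rewrite TK in KsT.
have [k0 k0T] : exists k0, k0 \in T.
  case h : T => [|k0 ?]; last by exists k0; rewrite mem_head.
  by move: dimW; rewrite h /dirs span_nil dimv0.
have hK : has_dim K d.
  apply/(vertex_list_dimP KsT _ k0T); apply: succn_inj; rewrite -dimW.
  rewrite (dirs_cone k0T (c := c) (b := b) (o := o)) // => [z|/(Fy _ os)//].
  by rewrite mem_filter => /andP[_ /sFb].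
have [|G [fcG KG GnF Go]] := adj K; first by apply/(facetP _ FsF hF).
have [g [bg [validg Gy GE _]]] := faceP Ps (facet_face fcG).
have go : dot g o = bg by apply/(Gy _ os).
have [f fs [Ff nGf]] : exists2 f, f \in s & F f /\ ~ G f.
  apply: contrapT => h; have FG : F `<=` G.
    apply: (face_subP Ps fF).
      by rewrite (face_conv Ps (facet_face fcG)); exact: conv_hull_convex.
    by move=> z zs Fz; apply: contrapT => nGz; apply: h; exists z.
  have [fG hG] := (facetP G Ps hd).1 fcG.
  have := face_dim_lt (face_vertex_list Ps fG) (sub_face fF FG (face_sub fG)) hG hF (nesym GnF).
  by rewrite ltnn.
have Wdot c2 : (forall z, z \in T -> dot c2 z = dot c2 o) ->
    forall w, w \in dirs o T -> dot c2 w = 0.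
  by move=> h w; apply: span_dot0 => z /h zo; rewrite dotB zo subrr.
have W1 : forall w, w \in dirs o T -> dot c1 w = 0.
  by apply: Wdot => z; rewrite mem_filter => /andP[/eqP].
have Wg : forall w, w \in dirs o T -> dot g w = 0.
  apply: Wdot => z zT; have [zF _] := andP (etrans (esym (mem_filter _ _ _)) zT).
  move: zT; rewrite -TK => /face_listP[/face_listP[zs _] Kz].
  by rewrite go; apply/(Gy _ zs)/KG.
have gf : dot g (f - o) < 0.
  rewrite dotB go subr_lt0 lt_neqAle validg // andbT.
  by apply: contra_notN nGf => /eqP/(Gy _ fs).
have DE : dirs o s = (dirs o T + <[f - o]>)%VS.
  apply/esym/eqP; rewrite eqEdim; apply/andP; split.
    rewrite subv_add; apply/andP; split; last by rewrite -memvE; exact: mem_dirs.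
    apply: sub_span => _ /mapP[z + ->]; rewrite -TK => /face_listP[/face_listP[zs _] _].
    exact: map_f.
  rewrite ((vertex_list_dimP Ps _ os).1 hd) dimv_disjoint_sum ?dimW ?dim_vline.
    have -> : f - o != 0 by apply: contraTneq gf => ->; rewrite dot0 ltxx.
    by rewrite addn1.
  apply/eqP; rewrite -subv0; apply/subvP => w /memv_capP[/Wg gw /vlineP[a wa]].
  move/eqP: gw; rewrite wa dotZ mulf_eq0 (lt_eqF gf) orbF => /eqP ->.
  by rewrite scale0r mem0v.
have := mem_dirs o ys; rewrite DE => /memv_addP[w wW [_ /vlineP[a ->] yw]].
move: pos; rewrite yw dotD W1 // add0r dotZ => pos.
have f1 : dot c1 (f - o) <= 0 by apply: valid1; apply/face_listP.
have a0 : a < 0.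
  by rewrite ltNge; apply/negP => a0; move: pos; rewrite ltNge mulr_ge0_le0.
have : dot g (y - o) <= 0 by rewrite dotB go subr_le0 validg.
by rewrite yw dotD Wg // add0r dotZ leNgt nmulr_rgt0 // gf.
Qed.

Lemma simplex_simple P s d u : vertex_list P s -> has_dim P d -> size s = d.+1 ->
  u \in s -> is_simple d P u.
Proof.
move=> Ps hd sd uS; have us : uniq s by case: Ps.
have [es bas] := exists_cone_basis u us; have [[ues ess ue eg] _] := bas.
apply/(is_simpleP Ps uS d bas); apply/eqP; rewrite eqn_leq; apply/andP; split.
  have : (size (u :: es) <= size s)%N.
    apply: uniq_leq_size; first by rewrite /= ue.
    by move=> z; rewrite inE => /predU1P[->|/ess].
  by rewrite sd.
move: hd => /(vertex_list_dimP Ps _ uS) <-; rewrite (spans_dirs (proj1 bas)).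
by apply: leq_trans (dim_span _) _; rewrite size_map.
Qed.

(** The neighbours of o all lie in the hyperplane of F, and F is the section of
    the cone at o by it.  So F is the hull of the d neighbours. *)
Lemma simple_apex P s d F o : vertex_list P s -> has_dim P d -> is_face P F ->
  o \in s -> ~ F o -> (forall y, y \in s -> F y \/ y = o) ->
  is_simple d P o -> size (face_list s F) = d.
Proof.
move=> Ps hd fF os nFo sFo so; have us : uniq s by case: Ps.
have [es [[ues ess oe eg] <- _]] := simple_basis Ps os hd so.
have [c [b [valid Fy _ _]]] := faceP Ps fF.
have esF e : e \in es -> e \in face_list s F.
  move=> ees; have eS := ess e ees; apply/face_listP; split=> //.
  by have [//|eo] := sFo e eS; move: oe; rewrite -eo ees.
apply/esym/perm_size/uniq_perm => //; first exact: filter_uniq.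
move=> v; apply/idP/idP => [/esF //|/face_listP[vs Fv]].
apply: (hull_vertex Ps vs ues ess); have [l l0 vl] := eg v vs.
apply: (@conv_cone _ _ _ o v l l0 _ vl).
have : (\sum_(e <- es) l e) * (b - dot c o) = 1 * (b - dot c o).
  rewrite mul1r -[in RHS]((Fy v vs).1 Fv) -dotB vl dot_sum mulr_suml.
  apply: eq_big_seq => e /esF /face_listP[eS /(Fy _ eS) eb].
  by rewrite dotB eb.
apply: mulIf; rewrite subr_eq0 eq_sym; apply/eqP => /(Fy _ os); exact: nFo.
Qed.

End Facets.

(** * Pyramids *)

Section Pyramids.
Variables (R : realType) (n : nat).
Local Notation V := 'rV[R]_n.
Implicit Types (A B P F G K : set V) (s t es : seq V) (u v x y o : V) (c : 'cV[R]_n).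

Definition nonsimple_list d P s := [seq y <- s | `[< ~ is_simple d P y >]].

(** The part of [is_pyramid] that concerns the vertices only; together with F
    being a facet it implies the rest, see [is_pyramid_over]. *)
Definition pyramid_over s F o := [/\ o \in s, ~ F o & forall y, y \in s -> F y \/ y = o].

Lemma mem_nonsimple d P s y :
  y \in nonsimple_list d P s <-> y \in s /\ ~ is_simple d P y.
Proof.
by rewrite mem_filter; split=> [/andP[/asboolP]|[-> /asboolP ->]].
Qed.

Lemma facet_vertex_outside P s d F : vertex_list P s -> has_dim P d -> is_facet P F ->
  exists2 o, o \in s & ~ F o.
Proof.
move=> Ps hd fcF; apply: contrapT => h; case: fcF => e [he fF hF].
have FP : F = P.
  apply: (face_eq Ps fF (face_refl P)) => y ys; split=> _; first exact: vertex_list_sub Ps _ ys.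
  by apply: contrapT => nFy; apply: h; exists y.
by rewrite FP in hF; have /eqP := vertex_list_dim_uniq Ps he hF; rewrite eqn_leq ltnn.
Qed.

Lemma max_facet s (good : set V -> Prop) F0 : good F0 ->
  exists2 F, good F &
    forall G, good G -> (size (face_list s G) <= size (face_list s F))%N.
Proof.
move=> gF0; pose p k := `[< exists2 F, good F & size (face_list s F) = k >].
have pex : exists k, p k by exists (size (face_list s F0)); apply/asboolP; exists F0.
have pub k : p k -> (k <= size s)%N.
  by move=> /asboolP[F _ <-]; rewrite size_filter count_size.
case: (ex_maxnP pex pub) => k /asboolP[F gF <-] kmax; exists F => // G gG.
by apply: kmax; apply/asboolP; exists G.
Qed.

(** The facet G opposite to w through K has at most as many vertices as F by the
    choice of F, hence a single vertex o outside K.  All simple vertices of F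
    lie in K, so o is the outer neighbour of each of them, and every facet of F
    contains one. *)
Lemma pyramid_of_nonsimple_apex P s d F K w : vertex_list P s -> has_dim P d.+1 ->
  is_facet P F -> is_facet F K ->
  (size (nonsimple_list d.+1 P s) <= d)%N ->
  (size (face_list (nonsimple_list d.+1 P s) F) <= d.-1)%N ->
  (forall G, is_facet P G -> (size (face_list (nonsimple_list d.+1 P s) G) <= d.-1)%N ->
     (size (face_list s G) <= size (face_list s F))%N) ->
  pyramid_over (face_list s F) K w -> w \in nonsimple_list d.+1 P s ->
  exists o, pyramid_over s F o.
Proof.
set T := nonsimple_list d.+1 P s.
move=> Ps hd fcF fcK T_le TF_le Fmax [wF nKw FKw] wT.
have us : uniq s by case: Ps.
have [fF hF] := (facetP F Ps hd).1 fcF; have FsF := face_vertex_list Ps fF.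
have [ws Fw] := (face_listP s F w).1 wF.
have [d' [hF' fK hK]] := fcK; have dd' := vertex_list_dim_uniq FsF hF hF'; subst d.
have [G [fcG GnF GF]] := other_facet Ps fcF fcK.
have [fG hG] := (facetP G Ps hd).1 fcG; have GsG := face_vertex_list Ps fG.
have nGw : ~ G w by move=> Gw; apply: nKw; rewrite -GF.
have G_le : (size (face_list s G) <= size (face_list s F))%N.
  apply: Fmax => //; rewrite /= size_filter -ltnS.
  apply: leq_trans T_le; rewrite -[X in (_ <= X)%N](count_predC (fun y => `[< G y >])).
  by rewrite -addn1 leq_add2l -has_count; apply/hasP; exists w => //=; apply/asboolP.
have [o os [Go nFo]] : exists2 o, o \in s & G o /\ ~ F o.
  apply: contrapT => h; have GsubF : G `<=` F.
    apply: (face_subP Ps fG).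
      by rewrite (face_conv Ps fF); exact: conv_hull_convex.
    by move=> z zs Gz; apply: contrapT => nFz; apply: h; exists z.
  have := face_dim_lt FsF (sub_face fG GsubF (face_sub fF)) hF hG GnF.
  by rewrite ltnn.
have Go_uniq o' : o' \in s -> G o' -> ~ F o' -> o' = o.
  move=> o's Go' nFo'; apply: contrapT => /eqP oo'; move: G_le.
  rewrite leqNgt => /negP; apply.
  have FK : {subset face_list s F <= w :: face_list s K}.
    move=> y yF; rewrite inE; have [Ky|->] := FKw y yF; last by rewrite eqxx.
    by apply/orP; right; apply/face_listP; split=> //; case/face_listP: yF.
  have := uniq_leq_size (filter_uniq _ us : uniq (face_list s F)) FK.
  rewrite /= => /leq_ltn_trans; apply.
  rewrite -[X in (X < _)%N]/(size (o' :: face_list s K)).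
  rewrite -[X in (X <= _)%N]/(size [:: o, o' & face_list s K]).
  have KF y : K y -> F y by rewrite -GF => -[].
  apply: uniq_leq_size.
    rewrite /= !inE negb_or eq_sym oo' filter_uniq // andbT /=; apply/andP; split.
      by apply/negP => /face_listP[_ /KF].
    by apply/negP => /face_listP[_ /KF].
  move=> y; rewrite !inE => /or3P[/eqP ->|/eqP ->|/face_listP[ys Ky]];
    apply/face_listP; split=> //.
  by move: Ky; rewrite -GF => -[].
exists o; split=> //; apply: (pyramid_of_common_apex Ps hd fcF os nFo) => K' fcK'.
have [G' [fcG' G'nF G'F]] := other_facet Ps fcF fcK'; exists G'; split=> //.
  by rewrite -G'F => x [].
have [fK' hK'] := (facetP K' FsF hF).1 fcK'.
have K'sK' := face_vertex_list FsF fK'.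
(* K' has dimension d', hence at least d'.+1 vertices, and at most d' of the
   vertices of F are nonsimple in P. *)
have [u uK' uT] : exists2 u, u \in face_list (face_list s F) K' & u \notin T.
  apply: contrapT => h; have := size_vertex_list K'sK' hK'; rewrite ltnNge => /negP; apply.
  apply: leq_trans TF_le; apply: uniq_leq_size; first by case: K'sK'.
  move=> y yK'; have /face_listP[/face_listP[ys Fy] _] := yK'.
  apply/face_listP; split=> //; apply: contrapT => /negP yT; by apply: h; exists y.
have /face_listP[uF K'u] := uK'; have /face_listP[uS Fu] := uF.
have Ku : K u.
  by have [//|uw] := FKw u uF; rewrite -uw (negbTE uT) in wT.
have us_simple : is_simple d'.+2 P u.
  by apply: contrapT => nsu; move/negP: uT; apply; apply/mem_nonsimple.
have [o' [o's nFo' outer]] := simple_outer Ps uS hd us_simple fcF Fu.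
have -> : o = o'.
  apply/esym/Go_uniq => //; apply: outer => //; by move: Ku; rewrite -GF => -[].
by apply: outer => //; move: K'u; rewrite -G'F => -[].
Qed.

(** The outer neighbours of the vertices of F cannot all be distinct, for lack
    of vertices.  Two vertices with the same one suffice, because each
    facet of the simplex F misses only one vertex. *)
Lemma pyramid_of_simple_simplex P s d F : vertex_list P s -> has_dim P d.+2 ->
  is_facet P F -> size (face_list s F) = d.+2 -> (size s < d.+2 + d.+2)%N ->
  (forall u, u \in face_list s F -> is_simple d.+2 P u) ->
  exists o, pyramid_over s F o.
Proof.
move=> Ps hd fcF sF s_lt simp; have us : uniq s by case: Ps.
have [fF hF] := (facetP F Ps hd).1 fcF; have FsF := face_vertex_list Ps fF.
have usF : uniq (face_list s F) by case: FsF.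
have /choice[f outer] : forall u, exists o, u \in face_list s F ->
   [/\ o \in s, ~ F o & forall G, is_facet P G -> G <> F -> G u -> G o].
  move=> u; have [uF|uF] := EM (u \in face_list s F); last by exists u.
  have /face_listP[uS Fu] := uF.
  by have [o ho] := simple_outer Ps uS hd (simp u uF) fcF Fu; exists o.
have [u [v [uF vF uv fuv]]] : exists u v, [/\ u \in face_list s F,
    v \in face_list s F, u != v & f u = f v].
  apply: contrapT => h; move: s_lt; rewrite ltnNge => /negP; apply.
  rewrite -sF -{2}(size_map f) -size_cat; apply: uniq_leq_size.
    rewrite cat_uniq usF /=; apply/andP; split.
      apply/hasPn => _ /mapP[y yF ->]; apply/negP => /face_listP[_].
      by have [] := outer y yF.
    rewrite map_inj_in_uniq // => x y xF yF fxy; apply: contrapT => /eqP xy.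
    by apply: h; exists x, y.
  move=> y; rewrite mem_cat => /orP[/face_listP[]//|/mapP[x xF ->]].
  by have [] := outer x xF.
have [os nFo outu] := outer u uF; have [_ _ outv] := outer v vF.
exists (f u); split=> //; apply: (pyramid_of_common_apex Ps hd fcF os nFo) => K fcK.
have [G [fcG GnF GF]] := other_facet Ps fcF fcK; exists G; split=> //.
  by rewrite -GF => x [].
have KG x : K x -> G x by rewrite -GF => -[].
have [fK hK] := (facetP K FsF hF).1 fcK; have KsK := face_vertex_list FsF fK.
have [Ku|nKu] := EM (K u); first by apply: outu => //; exact: KG.
have [Kv|nKv] := EM (K v); first by rewrite fuv; apply: outv => //; exact: KG.
have := size_vertex_list KsK hK; rewrite ltnNge => /negP; case.
rewrite -2!ltnS -sF -[X in (X <= _)%N]/(size [:: u, v & face_list (face_list s F) K]).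
apply: uniq_leq_size.
  rewrite /= inE negb_or uv filter_uniq // andbT /=; apply/andP.
  by split; apply/negP => /face_listP[].
by move=> y; rewrite !inE => /or3P[/eqP ->|/eqP ->|/face_listP[]].
Qed.

(** Some facet has at most d - 2 nonsimple vertices: any facet if P itself
    has no more, and otherwise a facet avoiding a nonsimple vertex. *)
Lemma few_nonsimple_pyramid d P s : vertex_list P s -> has_dim P d ->
  (size s < 2 * d)%N -> (size (nonsimple_list d P s) <= d.-1)%N ->
  exists F o, is_facet P F /\ pyramid_over s F o.
Proof.
elim: d P s => [|d IH] P s Ps hd; first by rewrite muln0.
move=> s_lt /= T_le; set T := nonsimple_list _ _ _ in T_le.
have us : uniq s by case: Ps.
pose good F := is_facet P F /\ (size (face_list T F) <= d.-1)%N.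
have [F0 gF0] : exists F, good F.
  have [x xs] := vertex_list_nonempty Ps hd.
  have [le|lt] := leqP (size T) d.-1.
    have [F fcF _] := facet_avoiding Ps hd xs.
    by exists F; split=> //; rewrite size_filter (leq_trans (count_size _ _)).
  have [y yT] : exists y, y \in T by case: (T) lt => // y ? _; exists y; rewrite mem_head.
  have [ys _] := (mem_nonsimple d.+1 P s y).1 yT.
  have [F fcF nFy] := facet_avoiding Ps hd ys; exists F; split=> //.
  have : (size (face_list T F) < size T)%N.
    rewrite size_filter -(count_predC (fun y => `[< F y >]) T) -addn1 leq_add2l -has_count.
    by apply/hasP; exists y => //=; apply/asboolP.
  lia.
have [F [fcF TF_le] Fmax] := max_facet s gF0; exists F.
have Fmax' G : is_facet P G -> (size (face_list T G) <= d.-1)%N ->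
    (size (face_list s G) <= size (face_list s F))%N by move=> *; apply: Fmax.
suff [o ho] : exists o, pyramid_over s F o by exists o.
have [fF hF] := (facetP F Ps hd).1 fcF; have FsF := face_vertex_list Ps fF.
have [large|small] := leqP (2 * d) (size (face_list s F)).
  have [o os nFo] := facet_vertex_outside Ps hd fcF; exists o; split=> // y ys.
  apply: contrapT => /not_orP[nFy /eqP yo].
  have : (size [:: o, y & face_list s F] <= size s)%N.
    apply: uniq_leq_size.
      rewrite /= inE negb_or eq_sym yo filter_uniq // andbT /=; apply/andP.
      by split; apply/negP => /face_listP[].
    by move=> z; rewrite !inE => /or3P[/eqP ->|/eqP ->|/face_listP[]].
  rewrite /=; lia.
have TF : {subset nonsimple_list d F (face_list s F) <= face_list T F}.
  move=> y /mem_nonsimple[/face_listP[ys Fy] nsy]; apply/face_listP; split=> //.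
  apply/mem_nonsimple; split=> // sy; apply: nsy.
  exact: simple_in_face Ps ys hd sy fF Fy hF.
have [|K [w [fcK KwF]]] := IH F (face_list s F) FsF hF small.
  by apply: leq_trans TF_le; apply: uniq_leq_size TF; rewrite !filter_uniq.
have [wT|wT] := boolP (w \in T).
  by apply: pyramid_of_nonsimple_apex KwF wT.
have [wF nKw FKw] := KwF; have [ws Fw] := (face_listP s F w).1 wF.
have ws_simple : is_simple d.+1 P w.
  by apply: contrapT => nsw; move/negP: wT; apply; apply/mem_nonsimple.
have [d' [hF' fK hK]] := fcK; have dd' := vertex_list_dim_uniq FsF hF hF'; subst d.
have wF_simple := simple_in_face Ps ws hd ws_simple fF Fw hF.
have sK := simple_apex FsF hF fK wF nKw FKw wF_simple.
have usF : uniq (face_list s F) by case: FsF.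
have sF : size (face_list s F) = d'.+2.
  apply/eqP; rewrite eqn_leq (size_vertex_list FsF hF) andbT -sK.
  rewrite -[X in (_ <= X)%N]/(size (w :: face_list (face_list s F) K)).
  apply: uniq_leq_size => // y yF; rewrite inE.
  have [Ky|->] := FKw y yF; last by rewrite eqxx.
  by apply/orP; right; apply/face_listP.
have [[w' w'F w'T]|none] := EM (exists2 w', w' \in face_list s F & w' \in T).
  have [K' fcK' nKw'] := facet_avoiding FsF hF w'F.
  apply: (pyramid_of_nonsimple_apex Ps hd fcF fcK' T_le TF_le Fmax' _ w'T).
  split=> // y yF; apply: contrapT => /not_orP[nKy /eqP yw'].
  have [fK' hK'] := (facetP K' FsF hF).1 fcK'.
  have := size_vertex_list (face_vertex_list FsF fK') hK'; rewrite ltnNge => /negP; apply.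
  rewrite -2!ltnS -sF.
  rewrite -[X in (X <= _)%N]/(size [:: y, w' & face_list (face_list s F) K']).
  apply: uniq_leq_size.
    rewrite /= inE negb_or yw' filter_uniq // andbT /=; apply/andP.
    by split; apply/negP => /face_listP[].
  by move=> z; rewrite !inE => /or3P[/eqP ->|/eqP ->|/face_listP[]].
apply: (pyramid_of_simple_simplex Ps hd fcF sF); first by lia.
move=> u uF; apply: contrapT => nsu; apply: none; exists u => //.
by apply/mem_nonsimple; split=> //; case/face_listP: uF.
Qed.

Lemma is_pyramid_over P s F o : vertex_list P s -> is_facet P F -> pyramid_over s F o ->
  is_pyramid P F o.
Proof.
move=> Ps fcF [os nFo sFo]; split=> //; first exact/(vertexP Ps).
have [us PE _] := Ps; apply/seteqP; split.
  rewrite {1}PE; apply: conv_hullS => y /= ys.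
  by have [Fy|->] := sFo y ys; [left|right].
apply: conv_hull_sub; first by rewrite PE; exact: conv_hull_convex.
by move=> y [/(face_sub (facet_face fcF))//|->]; exact: vertex_list_sub Ps _ os.
Qed.

(** The base F keeps the bound on nonsimple vertices.  If the apex o is nonsimple,
    it is one nonsimple vertex of P that F loses; if o is simple, F is a simplex
    and all its vertices are simple. *)
Lemma multifold_pyramid k m P s : vertex_list P s -> has_dim P (m + k) -> (0 < k)%N ->
  size s = (m + k + k)%N ->
  (size (nonsimple_list (m + k) P s) <= (m + k).-1)%N ->
  exists Q, [/\ is_polytope k Q, vertices Q #= `I_(2 * k)%N &
    is_multifold_pyramid m Q P].
Proof.
move=> Ps hd k0; elim: m P s Ps hd => [|m IH] P s Ps hd ss T_le.
  exists P; have [us PE vE] := Ps; split=> //; last first.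
    by rewrite vE; have := card_set_seq us; rewrite ss add0n mul2n addnn.
  by split=> //; exists [set` s] => //; exact: finite_seq.
have [|F [o [fcF pyr]]] := few_nonsimple_pyramid Ps hd _ T_le; first by lia.
have [os nFo sFo] := pyr; have [us _ _] := Ps.
have [fF hF] := (facetP F Ps hd).1 fcF; have FsF := face_vertex_list Ps fF.
have usF : uniq (face_list s F) by case: FsF.
have oF : o \notin face_list s F by apply/negP => /face_listP[].
have sF : size (face_list s F) = (m + k + k)%N.
  apply: succn_inj; rewrite -[RHS]ss -[LHS]/(size (o :: face_list s F)).
  apply/perm_size/uniq_perm => //; first by rewrite /= oF usF.
  move=> y; rewrite inE; apply/idP/idP => [/predU1P[->//|/face_listP[]//]|ys].
  have [Fy|->] := sFo y ys; last by rewrite eqxx.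
  by apply/orP; right; apply/face_listP.
suff TF_le : (size (nonsimple_list (m + k) F (face_list s F)) <= (m + k).-1)%N.
  have [Q [h1 h2 h3]] := IH F _ FsF hF sF TF_le.
  by exists Q; split=> //; exists F, o; split=> //; exact: (is_pyramid_over Ps fcF pyr).
have [so|nso] := EM (is_simple (m.+1 + k) P o).
  have s1 := simple_apex Ps hd fF os nFo sFo so.
  rewrite (_ : nonsimple_list _ _ _ = [::]) //.
  apply/eqP; rewrite -[_ == _]negbK -has_filter; apply/hasPn => y yF.
  by apply/asboolP => nsy; apply: nsy; exact: simplex_simple FsF hF s1 yF.
have TF : {subset o :: nonsimple_list (m + k) F (face_list s F) <=
    nonsimple_list (m.+1 + k) P s}.
  move=> y; rewrite inE => /predU1P[->|]; first by apply/mem_nonsimple.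
  move=> /mem_nonsimple[/face_listP[ys Fy] nsy]; apply/mem_nonsimple; split=> // sy.
  by apply: nsy; exact: simple_in_face Ps ys hd sy fF Fy hF.
have : (size (o :: nonsimple_list (m + k) F (face_list s F)) <= (m.+1 + k).-1)%N.
  apply: leq_trans T_le; apply: uniq_leq_size TF; rewrite /= !filter_uniq // andbT.
  by apply/negP => /mem_nonsimple[]; rewrite (negbTE oF).
by rewrite /=; lia.
Qed.

End Pyramids.

Theorem proposition10 (R : realType) (n d k : nat) (P : set 'rV[R]_n)
    (hk : (1 <= k)%N) (hkd : (k <= d)%N)
    (hP : is_polytope d P)
    (hvert : vertices P #= `I_(d + k)%N)
    (hnonsimple : nonsimple_vertices d P #<= `I_(d - 1)%N) :
  exists Q : set 'rV[R]_n,
    [/\ is_polytope k Q, vertices Q #= `I_(2 * k)%N &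
        is_multifold_pyramid (d - k)%N Q P].
Proof.
have [[S finS PS] hd] := hP; have [s Ps] := exists_vertex_list finS PS.
have [us _ vE] := Ps.
have ss : size s = (d + k)%N.
  apply/card_eq_II; apply: card_eq_trans hvert.
  by rewrite vE card_eq_sym card_set_seq.
have T_le : (size (nonsimple_list d P s) <= d.-1)%N.
  rewrite -subn1 -card_le_II; apply: card_le_trans hnonsimple.
  rewrite (_ : nonsimple_vertices d P = [set` nonsimple_list d P s]).
    have := card_set_seq (filter_uniq _ us : uniq (nonsimple_list d P s)).
    by rewrite card_eq_le => /andP[].
  by apply/seteqP; split=> y; rewrite /nonsimple_vertices vE /=;
     [move=> ?; apply/mem_nonsimple|move/mem_nonsimple].
by apply: (multifold_pyramid Ps); rewrite ?subnK.
Qed.
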